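(* Fix an interval $(x_1,x_2)$ and an average variance $\widehat{\sigma}^2/2>0$. The optimal relaxation time $\tau$ is a concave function of the stationary distribution: for all stationary densities $\pi_1,\dots,\pi_m$ on $(x_1,x_2)$ and all $p_1,\dots,p_m\ge0$ with $\sum_{i=1}^mp_i=1$, $$\tau\left(\sum_{i=1}^mp_i\pi_i\right)\ \ge\ \sum_{i=1}^mp_i\,\tau(\pi_i),$$ where $\tau(\pi)$ denotes the optimal relaxation time for the stationary density $\pi$ and the average variance $\widehat{\sigma}^2/2$.
   Context: Let $-\infty\le x_1<x_2\le\infty$. A stationary density $\pi$ is a continuous, strictly positive probability density on $(x_1,x_2)$ with finite second moment. A time-homogeneous diffusion $dX(t)=\mu(X(t))\,dt+\sigma(X(t))\,dW(t)$ on $(x_1,x_2)$ with reflecting boundary conditions is reversible with respect to $\pi$ if $\mu(x)=\frac{1}{2\pi(x)}\frac{d}{dx}\bigl(\sigma^2(x)\pi(x)\bigr)$. Its convergence rate $\lambda_1[\sigma^2]$ is the first nonzero eigenvalue of the Sturm-Liouville problem $$\frac12(\pi\sigma^2\phi')'+\lambda\pi\phi=0,\qquad \frac12\sigma^2\pi\phi'\to0\text{ at }x_1\text{ and }x_2,$$ given by the Rayleigh principle $$\lambda_1[\sigma^2]=\min_Q\int_{x_1}^{x_2}\frac12\sigma^2(x)\pi(x)\,Q'(x)^2\,dx,$$ where $Q$ ranges over continuously differentiable functions on $(x_1,x_2)$ with $\int\pi Q^2\,dx=1$, $\int\pi Q\,dx=0$ and $\frac12\sigma^2\pi Q'\to0$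 at $x_1$ and $x_2$. A variance function $\frac12\sigma^2$ is admissible for $\pi$ and $\widehat{\sigma}^2/2$ if $\sigma^2>0$ on $(x_1,x_2)$, $\sigma^2\pi$ is continuously differentiable on $(x_1,x_2)$, $\int_{x_1}^{x_2}\frac12\sigma^2\pi\,dx=\frac12\widehat{\sigma}^2$, and $\lambda_1[\sigma^2]$ exists (the minimum of $\int_{x_1}^{x_2}\frac12\sigma^2(x)\pi(x)\,Q'(x)^2\,dx$ over all continuously differentiable functions $Q$ on $(x_1,x_2)$ with $\int\pi Q^2\,dx=1$, $\int\pi Q\,dx=0$ and $\frac12\sigma^2\pi Q'\to0$ at $x_1$ and $x_2$ is attained). The optimal relaxation time is $\tau(\pi)=1/\max_{\sigma^2}\lambda_1[\sigma^2]$, the maximum being over all admissible variance functions. *)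

(* Defs.v *)
From mathcomp Require Import all_boot all_order all_algebra.
From mathcomp Require Import all_classical all_reals all_analysis.

Set Implicit Arguments.
Unset Strict Implicit.
Unset Printing Implicit Defensive.

Import Order.TTheory GRing.Theory Num.Theory.
Import numFieldNormedType.Exports.

Local Open Scope ring_scope.
Local Open Scope classical_set_scope.

(* Functions are total maps [R -> R]; only their values on the open interval
   (x1, x2) matter. *)

Definition open_itv (R : realType) (x1 x2 : \bar R) : set R :=
  [set x | (x1 < x%:E)%E /\ (x%:E < x2)%E].

(* The filter of neighbourhoods of an end point, taken inside the interval.
   The value at [+oo] for a lower end and at [-oo] for an upper end is
   irrelevant: these cases are excluded by [x1 < x2]. *)
Definition lower_end (R : realType) (x1 : \bar R) : set_system R :=
  match x1 with
  | r%:E => r^'+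
  | -oo => ninfty_nbhs R
  | +oo => pinfty_nbhs R
  end%E.

Definition upper_end (R : realType) (x2 : \bar R) : set_system R :=
  match x2 with
  | r%:E => r^'-
  | +oo => pinfty_nbhs R
  | -oo => ninfty_nbhs R
  end%E.

Definition cont_diff_on (R : realType) (D : set R) (f : R -> R) : Prop :=
  (forall x, D x -> derivable f x 1) /\ {in D, continuous (derive1 f)}.

Definition is_least (d : Order.disp_t) (T : porderType d) (A : set T) (m : T) :=
  A m /\ lbound A m.

Definition is_greatest (d : Order.disp_t) (T : porderType d) (A : set T)
    (m : T) :=
  A m /\ ubound A m.

Definition stationary_density (R : realType) (x1 x2 : \bar R) (pi : R -> R) :
    Prop :=
  [/\ {in open_itv x1 x2, continuous pi},
      forall x, open_itv x1 x2 x -> 0 < pi x,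
      (\int[lebesgue_measure]_(x in open_itv x1 x2) (pi x)%:E = 1)%E
    & (\int[lebesgue_measure]_(x in open_itv x1 x2) (x ^+ 2 * pi x)%:E < +oo)%E].

(* Throughout, [s2] is the function sigma^2. *)

Definition trial_function (R : realType) (x1 x2 : \bar R) (pi s2 Q : R -> R) :
    Prop :=
  let flux (x : R) : R := 2^-1 * s2 x * pi x * derive1 Q x in
  [/\ cont_diff_on (open_itv x1 x2) Q,
      (\int[lebesgue_measure]_(x in open_itv x1 x2) (pi x * Q x ^+ 2)%:E = 1)%E,
      (\int[lebesgue_measure]_(x in open_itv x1 x2) (pi x * Q x)%:E = 0)%E,
      flux @ lower_end x1 --> 0
    & flux @ upper_end x2 --> 0].

(* Extended-real valued: the energy of a trial function may be infinite. *)
Definition energy (R : realType) (x1 x2 : \bar R) (pi s2 Q : R -> R) : \bar R :=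
  (\int[lebesgue_measure]_(x in open_itv x1 x2)
     (2^-1 * s2 x * pi x * derive1 Q x ^+ 2)%:E)%E.

(* [l] is lambda_1[sigma^2], the attained minimum of the Rayleigh principle. *)
Definition is_lambda1 (R : realType) (x1 x2 : \bar R) (pi s2 : R -> R) (l : R) :
    Prop :=
  is_least [set energy x1 x2 pi s2 Q | Q in trial_function x1 x2 pi s2] l%:E.

(* [v] is the prescribed average variance, hat(sigma)^2 / 2. *)
Definition admissible (R : realType) (x1 x2 : \bar R) (v : R) (pi s2 : R -> R) :
    Prop :=
  [/\ forall x, open_itv x1 x2 x -> 0 < s2 x,
      cont_diff_on (open_itv x1 x2) (fun x => s2 x * pi x),
      (\int[lebesgue_measure]_(x in open_itv x1 x2)
          (2^-1 * s2 x * pi x)%:E = v%:E)%E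
    & exists l : R, is_lambda1 x1 x2 pi s2 l].

Definition convergence_rates (R : realType) (x1 x2 : \bar R) (v : R)
    (pi : R -> R) : set R :=
  [set l | exists2 s2, admissible x1 x2 v pi s2 & is_lambda1 x1 x2 pi s2 l].

Definition max_rate_exists (R : realType) (x1 x2 : \bar R) (v : R)
    (pi : R -> R) : Prop :=
  exists l, is_greatest (convergence_rates x1 x2 v pi) l.

(* The greatest element is unique when it exists, so [xget] selects the maximum;
   the default value 0 is meaningful only if [max_rate_exists] fails. *)
Definition max_rate (R : realType) (x1 x2 : \bar R) (v : R) (pi : R -> R) : R :=
  xget 0 (is_greatest (convergence_rates x1 x2 v pi)).

Definition optimal_relaxation_time (R : realType) (x1 x2 : \bar R) (v : R)
    (pi : R -> R) : R :=
  1 / max_rate x1 x2 v pi.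

(* Main.v *)
Require Import Defs.
From mathcomp Require Import all_boot all_order all_algebra.
From mathcomp Require Import all_classical all_reals all_analysis.
From mathcomp Require Import measurable_realfun ring lra.

Import Order.TTheory GRing.Theory Num.Theory.
Import numFieldNormedType.Exports.

Local Open Scope ring_scope.
Local Open Scope classical_set_scope.

Set Implicit Arguments.
Unset Strict Implicit.
Unset Printing Implicit Defensive.

(** Write m and V for the mean and the variance of a stationary density pi.
    The optimal relaxation time has the closed form

      tau(pi) = V / v,

    where v is the prescribed average variance, so its concavity is that of
    the variance.  For a mixture with mean M, each component contributes its
    second moment about M, and the second moment of a density about any point
    is at least its variance ([variance_le], [variance_concave]).

    The closed form amounts to: the greatest convergence rate is v / V
    ([convergence_rates_greatest]).

    - No admissible sigma^2 does better.  Tested on the identity, normalized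
      to mean 0 and norm 1, the Rayleigh quotient would be v / V.  The
      identity need not satisfy the boundary conditions, so it is replaced by
      a C^1 clamp: equal to the identity on a compact [a, b], constant near
      the ends, and with slope in [0, 1] ([smooth_clamp]).  Its energy is at
      most v before normalization and its variance is close to V
      ([clamp_trial], [lambda1_clamp_le], [lambda1_le]).

    - The rate v / V is reached.  The function for which the identity is an
      exact eigenfunction is sigma^2 pi / 2 = (v / V) K, with K the Stein
      kernel K(t) = int_(x1)^t (m - y) pi(y) dy.  It vanishes at both ends,
      because pi has mean m and the moments are tight
      ([stein_kernel_lower_end], [stein_kernel_upper_end]), its integral is V
      ([stein_kernel_integral]), and it satisfies the Poincare inequality
      int pi (Q - Q(m))^2 <= int Q'^2 K ([stein_poincare]).  This inequality
      is elementary: by Cauchy-Schwarz (Q(x) - Q(m))^2 is at most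
      |x - m| times the integral of Q'^2 between m and x, and exchanging the
      order of integration turns |x - m| pi(x) into K
      ([increment_sqr_between], [stein_kernel_swap]).  For Q of mean 0 and
      norm 1 the left-hand side is 1 + Q(m)^2 >= 1. *)

(** * Integrability of real functions and geometry of the interval *)

Section real_integrable.
Context d (T : measurableType d) (R : realType) (mu : {measure set T -> \bar R}).
Variables (D : set T) (mD : measurable D).
Implicit Types f g : T -> R.

Lemma integrableZl_EFin f k : mu.-integrable D (EFin \o f) ->
  mu.-integrable D (EFin \o (fun x => k * f x)).
Proof.
by move=> /(integrableZl mD k); apply: eq_integrable.
Qed.

Lemma integrableD_EFin f g : mu.-integrable D (EFin \o f) ->
  mu.-integrable D (EFin \o g) -> mu.-integrable D (EFin \o (fun x => f x + g x)).
Proof.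
by move=> fi gi; have := integrableD mD fi gi; apply: eq_integrable.
Qed.

Lemma integrableB_EFin f g : mu.-integrable D (EFin \o f) ->
  mu.-integrable D (EFin \o g) -> mu.-integrable D (EFin \o (fun x => f x - g x)).
Proof.
by move=> fi gi; have := integrableB mD fi gi; apply: eq_integrable.
Qed.

Lemma Rintegral_fineK f : mu.-integrable D (EFin \o f) ->
  (\int[mu]_(x in D) (f x)%:E)%E = (Rintegral mu D f)%:E.
Proof. by move=> fi; rewrite /Rintegral fineK//; exact: integrable_fin_num. Qed.

Lemma ge0_integrable f : measurable_fun D f -> (forall x, D x -> 0 <= f x) ->
  (\int[mu]_(x in D) (f x)%:E < +oo)%E -> mu.-integrable D (EFin \o f).
Proof.
move=> mf f0 foo; apply/integrableP; split; first exact/measurable_EFinP.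
rewrite (eq_integral (EFin \o f))// => x; rewrite inE => /f0 fx.
by rewrite /= ger0_norm.
Qed.

Lemma le_integrable_EFin f g : measurable_fun D f ->
  (forall x, D x -> `|f x| <= g x) ->
  mu.-integrable D (EFin \o g) -> mu.-integrable D (EFin \o f).
Proof.
move=> mf fg; apply: le_integrable => //; first exact/measurable_EFinP.
by move=> x Dx; rewrite /= lee_fin (le_trans (fg _ Dx))// ler_norm.
Qed.

End real_integrable.

Lemma measurable_fun_boolR {R : realType} d (T : measurableType d) (D : set T)
    (b : T -> bool) :
  measurable_fun D b -> measurable_fun D (fun x => (b x)%:R : R).
Proof. by move=> mb; apply: (measurableT_comp (f := fun b : bool => b%:R : R)). Qed.

#[local] Instance lower_end_filter (R : realType) (x : \bar R) : Filter (lower_end x).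
Proof. by case: x => [r| |]; rewrite /lower_end; exact: filter_filter. Qed.

#[local] Instance upper_end_filter (R : realType) (x : \bar R) : Filter (upper_end x).
Proof. by case: x => [r| |]; rewrite /upper_end; exact: filter_filter. Qed.

Section interval.
Context {R : realType}.
Variables x1 x2 : \bar R.
Local Notation D := (open_itv x1 x2).
Local Notation mu := (@lebesgue_measure R).

Lemma open_open_itv : open D.
Proof. by apply: openI; [exact: open_ereal_gt | exact: open_ereal_lt]. Qed.

Lemma measurable_open_itv : measurable D.
Proof. by apply: open_measurable; exact: open_open_itv. Qed.

Lemma open_itv_convex (x y z : R) : D x -> D y -> x <= z <= y -> D z.
Proof.
move=> [x1x _] [_ yx2] /andP[xz zy]; split.
- by rewrite (lt_le_trans x1x)// lee_fin.
- by rewrite (le_lt_trans _ yx2)// lee_fin.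
Qed.

Lemma near_open_itv (x : R) : D x -> \forall y \near x, D y.
Proof. by move=> Dx; apply: open_nbhs_nbhs; split => //; exact: open_open_itv. Qed.

Lemma measurable_open_itv_continuous (f : R -> R) :
  {in D, continuous f} -> measurable_fun D f.
Proof. by apply: open_continuous_measurable_fun; exact: open_open_itv. Qed.

(** Pins down the only part of the end filter that is ever used: close to
    [x1], points lie in the interval and before any given point of it. *)
Lemma near_lower_end (a : R) : D a ->
  \forall x \near lower_end x1, x < a /\ (x1 < x%:E)%E.
Proof.
case=> + _; rewrite /lower_end; case: x1 => [r| |]//=; rewrite ?lte_fin => ra.
- near=> x; split.
  + by near: x; exact: nbhs_right_lt.
  + by rewrite lte_fin; near: x; exact: nbhs_right_gt.
- near=> x; split; last exact: ltNyr.
  by near: x; exact: nbhs_ninfty_lt.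
Unshelve. all: by end_near. Qed.

Lemma near_upper_end (b : R) : D b ->
  \forall x \near upper_end x2, b < x /\ (x%:E < x2)%E.
Proof.
case=> _; rewrite /upper_end; case: x2 => [r| |]//=; rewrite ?lte_fin => ra.
- near=> x; split.
  + by near: x; exact: nbhs_left_gt.
  + by rewrite lte_fin; near: x; exact: nbhs_left_lt.
- near=> x; split; last exact: ltry.
  by near: x; exact: nbhs_pinfty_gt.
Unshelve. all: by end_near. Qed.

(** The sequence stays below [c] so that compact intervals built from it can
    be made to contain a chosen point. *)
Lemma exhaust_down (c : R) : D c -> exists2 a_ : nat -> R,
  forall n, D (a_ n) /\ a_ n <= c &
  forall x, D x -> \forall n \near \oo, a_ n < x.
Proof.
case; rewrite /open_itv; case: x1 => [r| |]//= + cx2.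
- rewrite lte_fin => rc.
  exists (fun n => r + (c - r) * n.+1%:R^-1).
  + move=> n; have n0 : 0 < n.+1%:R^-1 :> R by rewrite invr_gt0.
    have n1 : n.+1%:R^-1 <= 1 :> R by rewrite invf_le1// ler1n.
    move: (n.+1%:R^-1) n0 n1 => t n0 n1.
    have p1 : 0 <= (c - r) * (1 - t) by apply: mulr_ge0; lra.
    have p2 : 0 < (c - r) * t by apply: mulr_gt0; lra.
    have le : r + (c - r) * t <= c by lra.
    split => //; split; last by rewrite (le_lt_trans _ cx2)// lee_fin.
    by rewrite lte_fin; lra.
  + move=> x [rx _]; rewrite lte_fin in rx.
    have : (fun n => (c - r) * @harmonic R n) @ \oo --> (c - r) * 0.
      exact: cvgMr cvg_harmonic.
    rewrite mulr0 => /cvgr_lt /(_ (x - r)); rewrite subr_gt0 => /(_ rx).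
    by apply: filterS => n /=; rewrite /harmonic; move: (n.+1%:R^-1) => t; lra.
- move=> _; exists (fun n => c - n%:R).
  + move=> n; have n0 : 0 <= n%:R :> R by [].
    have le : c - n%:R <= c by lra.
    split => //; split; first exact: ltNyr.
    by rewrite (le_lt_trans _ cx2)// lee_fin.
  + move=> x _; have := @cvgr_idn R => /cvgryPgt /(_ (c - x)).
    by apply: filterS => n /=; lra.
Qed.

Lemma exhaust_up (c : R) : D c -> exists2 b_ : nat -> R,
  forall n, D (b_ n) /\ c <= b_ n &
  forall x, D x -> \forall n \near \oo, x < b_ n.
Proof.
case=> x1c; rewrite /open_itv; case: x2 => [r| |]//=.
- rewrite lte_fin => rc.
  exists (fun n => r - (r - c) * n.+1%:R^-1).
  + move=> n; have n0 : 0 < n.+1%:R^-1 :> R by rewrite invr_gt0.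
    have n1 : n.+1%:R^-1 <= 1 :> R by rewrite invf_le1// ler1n.
    move: (n.+1%:R^-1) n0 n1 => t n0 n1.
    have p1 : 0 <= (r - c) * (1 - t) by apply: mulr_ge0; lra.
    have p2 : 0 < (r - c) * t by apply: mulr_gt0; lra.
    have le : c <= r - (r - c) * t by lra.
    split => //; split; first by rewrite (lt_le_trans x1c)// lee_fin.
    by rewrite lte_fin; lra.
  + move=> x [_ rx]; rewrite lte_fin in rx.
    have : (fun n => (r - c) * @harmonic R n) @ \oo --> (r - c) * 0.
      exact: cvgMr cvg_harmonic.
    rewrite mulr0 => /cvgr_lt /(_ (r - x)); rewrite subr_gt0 => /(_ rx).
    by apply: filterS => n /=; rewrite /harmonic; move: (n.+1%:R^-1) => t; lra.
- move=> _; exists (fun n => c + n%:R).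
  + move=> n; have n0 : 0 <= n%:R :> R by [].
    have le : c <= c + n%:R by lra.
    split => //; split; last exact: ltry.
    by rewrite (lt_le_trans x1c)// lee_fin.
  + move=> x _; have := @cvgr_idn R => /cvgryPgt /(_ (x - c)).
    by apply: filterS => n /=; lra.
Qed.

(** Dominated convergence along compact intervals that exhaust [D]. The
    interval is required to contain a given point because it is applied with
    the mean, where centered moments change sign. *)
Lemma integrable_tight (g : R -> R) (c e : R) : mu.-integrable D (EFin \o g) ->
  D c -> 0 < e ->
  exists a b, [/\ D a, D b, a <= c, c <= b &
    \int[mu]_(x in D) ((~~ (a <= x <= b))%:R * `|g x|) <= e].
Proof.
move=> ig Dc e0.
have [a_ Da ca] := exhaust_down Dc; have [b_ Db cb] := exhaust_up Dc.
pose f_ n x := ((~~ (a_ n <= x <= b_ n))%:R * `|g x|)%:E.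
have mg : measurable_fun D g by apply/measurable_EFinP; exact: measurable_int ig.
have mf n : measurable_fun D (f_ n).
  apply/measurable_EFinP; apply: measurable_funM.
  - apply: measurable_fun_boolR; apply: measurable_neg.
    by apply: measurable_and; exact: measurable_fun_ler.
  - exact: measurableT_comp.
have [_ _ h] : [/\ mu.-integrable D (cst 0%E : R -> \bar R),
    [sequence (\int[mu]_(x in D) `|f_ n x - cst 0%E x|)%E]_n @ \oo --> 0%E &
    [sequence (\int[mu]_(x in D) f_ n x)%E]_n @ \oo -->
      (\int[mu]_(x in D) cst 0%E x)%E].
  apply: (@dominated_convergence _ _ _ mu D measurable_open_itv f_ (cst 0%E)
    (fun x => `|(g x)%:E|%E)) => //.
  - apply: aeW => x Dx; apply: cvg_near_cst.
    near=> n; rewrite /f_.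
    have -> : a_ n <= x <= b_ n.
      by apply/andP; split; apply: ltW; near: n; [exact: ca|exact: cb].
    by rewrite /= mul0r.
  - exact: integrable_abse ig.
  - apply: aeW => x n Dx; rewrite /f_ lee_fin normrM normr_id ler_piMl//.
    by case: (~~ _) => /=; rewrite ?normr1 ?normr0.
move: h; rewrite integral0 => /fine_cvgP[_] /cvgr_le /(_ _ e0)[n _ /(_ n (leqnn _))/= h].
exists (a_ n), (b_ n); split; [exact: (Da n).1|exact: (Db n).1|exact: (Da n).2|exact: (Db n).2|].
exact: h.
Unshelve. all: by end_near. Qed.

End interval.

(** * A smooth clamp and the Cauchy-Schwarz bound on increments *)

Section smooth_clamp.
Context {R : realType}.
Implicit Types a b c d x s : R.

Let ramp s : R := Num.max s 0.
Let Ramp s : R := ramp s ^+ 2 / 2.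

(** [Ramp] is convex with slope 1-Lipschitz, so its first-order remainder lies
    between 0 and h^2 / 2; this gives the derivative at every point, the kink
    included. *)
Let Ramp_taylor x h : 0 <= Ramp (x + h) - Ramp x - h * ramp x <= h ^+ 2 / 2.
Proof.
rewrite /Ramp /ramp; case: (leP x 0) => x0; case: (leP (x + h) 0) => xh0; nra.
Qed.

Let Ramp_decr d s : 0 < d -> 0 <= Ramp s - Ramp (s - d) <= ramp s * d.
Proof.
rewrite /Ramp /ramp; case: (leP s 0) => s0; case: (leP (s - d) 0) => sd0; nra.
Qed.

Let is_derive_Ramp x : is_derive x 1 Ramp (ramp x).
Proof.
have h : (fun h => h^-1 *: ((Ramp \o shift x) (h *: 1) - Ramp x)) @ 0^' --> ramp x.
  apply/cvgrPdist_le => e e0; near=> h.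
  have h0 : h != 0 by near: h; exact: nbhs_dnbhs_neq.
  have he : `|h| <= e by near: h; apply: dnbhs0_le.
  have /andP[t1 t2] := Ramp_taylor x h.
  rewrite [X in `|X|](_ : _ = - ((Ramp (x + h) - Ramp x - h * ramp x) * h^-1)); last first.
    rewrite /= /GRing.scale /= mulr1 [h + x]addrC; by field.
  rewrite normrN normrM (ger0_norm t1) normfV ler_pdivrMr ?normr_gt0//.
  apply: (le_trans t2).
  have -> : h ^+ 2 = `|h| * `|h| by rewrite -normrM -expr2 ger0_norm// sqr_ge0.
  have := normr_ge0 h; nra.
have dR : derivable Ramp x 1 by apply/cvg_ex; exists (ramp x).
by apply: DeriveDef => //; apply/cvg_lim => //; exact: Rhausdorff.
Unshelve. all: by end_near. Qed.

Let ramp_continuous : continuous ramp.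
Proof. by move=> x; apply: continuous_max => //; exact: cvg_cst. Qed.

(** Primitive of a trapezoidal bump: the slope is 1 on [a, b], decreases
    linearly to 0 on intervals of length [d] on both sides and stays 0. The
    last clause says that the clamp moves [x] towards [a, b], hence by no more
    than the distance from [x] to any point of [a, b]. *)
Lemma smooth_clamp a b d : a <= b -> 0 < d -> exists Q q : R -> R,
  [/\ forall x, is_derive x 1 Q (q x), continuous q, forall x, 0 <= q x <= 1,
      forall x, x <= a - d \/ b + d <= x -> q x = 0 &
      [/\ forall x, a <= x <= b -> Q x = x &
       forall x c, a <= c <= b -> `|Q x - x| <= `|x - c|] ].
Proof.
move=> ab d0.
pose Q x := x - (Ramp (x - b) - Ramp (x - (b + d))) / d
              + (Ramp (a - x) - Ramp (a - d - x)) / d.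
pose q x := 1 - (ramp (x - b) - ramp (x - (b + d))) / d
              - (ramp (a - x) - ramp (a - d - x)) / d.
have dec s : [/\ 0 <= 1 - (ramp s - ramp (s - d)) / d <= 1,
    s <= 0 -> (ramp s - ramp (s - d)) / d = 0 &
    d <= s -> (ramp s - ramp (s - d)) / d = 1].
  split.
  - have /andP[w0 wd] : 0 <= ramp s - ramp (s - d) <= d.
      by rewrite /ramp; case: (leP s 0) => ?; case: (leP (s - d) 0) => ?; lra.
    have : 0 <= (ramp s - ramp (s - d)) / d by rewrite divr_ge0// ltW.
    have : (ramp s - ramp (s - d)) / d <= 1 by rewrite ler_pdivrMr// mul1r.
    by move: (_ / d) => w; lra.
  - by move=> s0; rewrite /ramp !max_r ?subrr ?mul0r//; lra.
  - move=> sd; rewrite /ramp !max_l; [|lra|lra].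
    by rewrite opprB addrCA subrr addr0 divff// gt_eqF.
exists Q, q; split; [| | | |split].
- move=> x; rewrite /Q.
  have d1 y : is_derive x 1 (fun x => Ramp (x - y)) (ramp (x - y)).
    have := @is_derive1_comp R Ramp (fun x => x - y) x _ _ (is_derive_Ramp _) _.
    by move=> /(_ 1); rewrite mulr1; apply; apply: is_derive_eq; rewrite subr0.
  have d2 y : is_derive x 1 (fun x => Ramp (y - x)) (- ramp (y - x)).
    have := @is_derive1_comp R Ramp (fun x => y - x) x _ _ (is_derive_Ramp _) _.
    by move=> /(_ (-1)); rewrite mulrN1; apply; apply: is_derive_eq; rewrite add0r mul1r.
  have := d1 b; have := d1 (b + d); have := d2 a; have := d2 (a - d) => ? ? ? ?.
  apply: is_derive_eq; rewrite /q /GRing.scale/=; lra.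
- move=> x; rewrite /q.
  have c1 y : (fun x => ramp (x - y)) @ x --> ramp (x - y).
    have h : (fun x => x - y) @ x --> x - y.
      by apply: cvgB; [exact: cvg_id|exact: cvg_cst].
    exact: (continuous_comp (f := fun x => x - y) (g := ramp) h (@ramp_continuous _)).
  have c2 y : (fun x => ramp (y - x)) @ x --> ramp (y - x).
    have h : (fun x => y - x) @ x --> y - x.
      by apply: cvgB; [exact: cvg_cst|exact: cvg_id].
    exact: (continuous_comp (f := fun x => y - x) (g := ramp) h (@ramp_continuous _)).
  apply: cvgB; first apply: cvgB; first exact: cvg_cst.
    by apply: cvgMl; apply: cvgB.
  by apply: cvgMl; apply: cvgB.
- move=> x; have -> : q x = 1 - (ramp (x - b) - ramp (x - b - d)) / d
                              - (ramp (a - x) - ramp (a - x - d)) / d.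
    by rewrite /q; congr (1 - (_ - ramp _) / d - (_ - ramp _) / d); ring.
  have [/andP[u0 u1] u2 _] := dec (x - b).
  have [/andP[w0 w1] w2 _] := dec (a - x).
  have [xb|xb] := leP x b.
    rewrite u2; last lra.
    by rewrite subr0 w0.
  rewrite w2; last lra.
  by rewrite subr0 u0.
- move=> x; have -> : q x = 1 - (ramp (x - b) - ramp (x - b - d)) / d
                              - (ramp (a - x) - ramp (a - x - d)) / d.
    by rewrite /q; congr (1 - (_ - ramp _) / d - (_ - ramp _) / d); ring.
  have [_ u2 u3] := dec (x - b); have [_ w2 w3] := dec (a - x).
  case=> xab; [rewrite u2 ?w3|rewrite u3 ?w2]; try lra.
- move=> x /andP[ax xb]; rewrite /Q /Ramp /ramp.
  by rewrite !max_r ?expr0n/= ?mul0r ?subrr ?mul0r ?subr0 ?addr0//; lra.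
- move=> x c /andP[ac cb].
  have -> : Q x - x = ((Ramp (a - x) - Ramp (a - d - x))
      - (Ramp (x - b) - Ramp (x - (b + d)))) / d by rewrite /Q; field; rewrite gt_eqF.
  rewrite normrM normfV (gtr0_norm d0) ler_pdivrMr//.
  have decR s : 0 <= Ramp s - Ramp (s - d) <= ramp s * d.
    exact: Ramp_decr.
  have rle s t : s <= `|t| -> ramp s * d <= `|t| * d.
    by move=> st; rewrite ler_pM2r// /ramp ge_max st normr_ge0.
  have /andP[A0 A1] := decR (a - x); have /andP[B0 B1] := decR (x - b).
  have A2 : ramp (a - x) * d <= `|x - c| * d.
    by apply: rle; rewrite distrC; apply: le_trans (ler_norm _); lra.
  have B2 : ramp (x - b) * d <= `|x - c| * d.
    by apply: rle; apply: le_trans (ler_norm _); lra.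
  have -> : a - d - x = a - x - d by ring.
  have -> : x - (b + d) = x - b - d by ring.
  by rewrite ler_norml; lra.
Qed.

End smooth_clamp.

Section cauchy_schwarz.
Context {R : realType}.
Variables x1 x2 : \bar R.
Local Notation D := (open_itv x1 x2).
Local Notation mu := (@lebesgue_measure R).
Variable Q : R -> R.
Hypothesis dQ : cont_diff_on D Q.

Lemma within_itv_continuous (f : R -> R) (a b : R) : {in D, continuous f} ->
  D a -> D b -> {within `[a, b], continuous f}.
Proof.
move=> cf Da Db; apply: continuous_in_subspaceT => x.
rewrite inE/= in_itv/= => xab; apply: cf; rewrite inE.
exact: open_itv_convex xab.
Qed.

Lemma cont_diff_continuous : {in D, continuous Q}.
Proof.
move=> x; rewrite inE => Dx; apply: differentiable_continuous.
by apply/derivable1_diffP; exact: dQ.1.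
Qed.

Lemma itv_integrable (f : R -> R) (a b : R) : {in D, continuous f} ->
  D a -> D b -> mu.-integrable `[a, b] (EFin \o f).
Proof.
move=> cf Da Db; apply: continuous_compact_integrable; first exact: segment_compact.
exact: within_itv_continuous.
Qed.

Lemma derive1_sqr_continuous : {in D, continuous (fun x => derive1 Q x ^+ 2)}.
Proof.
have -> : (fun x => derive1 Q x ^+ 2) = (fun x => derive1 Q x * derive1 Q x).
  by apply/funext => y; rewrite expr2.
by move=> x Dx; apply: cvgM; exact: dQ.2.
Qed.

(** Cauchy-Schwarz for [Q'] against the constant 1, obtained by integrating
    (Q' - c)^2 >= 0 with [c] the mean slope. *)
Lemma increment_sqr_le (a b : R) : D a -> D b -> a <= b ->
  (Q b - Q a) ^+ 2 <= (b - a) * \int[mu]_(x in `[a, b]) (derive1 Q x ^+ 2).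
Proof.
move=> Da Db; rewrite le_eqVlt => /predU1P[->|ab].
  by rewrite !subrr expr0n mul0r.
have cq : {in D, continuous (derive1 Q)} := dQ.2.
have iq := itv_integrable cq Da Db; have iq2 := itv_integrable derive1_sqr_continuous Da Db.
have ftc : \int[mu]_(x in `[a, b]) derive1 Q x = Q b - Q a.
  rewrite /Rintegral.
  have -> // : (\int[mu]_(x in `[a, b]) (derive1 Q x)%:E =
      (Q b)%:E - (Q a)%:E)%E.
  apply: continuous_FTC2 ab _ _ _; [|split|by []].
  - exact: within_itv_continuous.
    + move=> x; rewrite in_itv/= => /andP[ax xb]; apply: dQ.1.
      by apply: (open_itv_convex Da Db); rewrite !ltW.
    + by apply: cvg_at_right_filter; apply: cont_diff_continuous; rewrite inE.
    + by apply: cvg_at_left_filter; apply: cont_diff_continuous; rewrite inE.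
set c := (Q b - Q a) / (b - a).
have ic : mu.-integrable `[a, b] (EFin \o (fun=> c ^+ 2)).
  apply: continuous_compact_integrable; first exact: segment_compact.
  by apply: continuous_subspaceT => x; exact: cvg_cst.
have i2q : mu.-integrable `[a, b] (EFin \o (fun x => 2 * c * derive1 Q x)).
  exact: integrableZl_EFin.
have idiff : mu.-integrable `[a, b] (EFin \o (fun x => derive1 Q x ^+ 2 - 2 * c * derive1 Q x)).
  exact: integrableB_EFin.
have : 0 <= \int[mu]_(x in `[a, b]) ((derive1 Q x ^+ 2 - 2 * c * derive1 Q x) + c ^+ 2).
  apply: Rintegral_ge0 => x _; rewrite (_ : _ + _ = (derive1 Q x - c) ^+ 2) ?sqr_ge0//.
  by ring.
rewrite RintegralD// RintegralB// RintegralZl// ftc Rintegral_cst//=.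
rewrite lebesgue_measure_itv/= lte_fin ab/=.
set I := Rintegral _ _ _.
have ba : 0 < b - a by lra.
have -> : (Q b - Q a) ^+ 2 = (b - a) * (2 * c * (Q b - Q a) - c ^+ 2 * (b - a)).
  by rewrite /c; field; rewrite gt_eqF.
by rewrite ler_pM2l//; lra.
Qed.

End cauchy_schwarz.

(** * Moments of a stationary density *)

Section density.
Context {R : realType}.
Variables (x1 x2 : \bar R) (pi : R -> R).
Hypothesis hpi : stationary_density x1 x2 pi.
Local Notation D := (open_itv x1 x2).
Local Notation mu := (@lebesgue_measure R).
Let mD : measurable (D : set (measurableTypeR R)) := @measurable_open_itv R x1 x2.

Lemma density_gt0 x : D x -> 0 < pi x.
Proof. by case: hpi => _ + _ _; apply. Qed.

Lemma measurable_density : measurable_fun D pi.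
Proof. by apply: measurable_open_itv_continuous; case: hpi. Qed.

Lemma density_integrable : mu.-integrable D (EFin \o pi).
Proof.
apply: ge0_integrable => //; first exact: measurable_density.
- by move=> x /density_gt0 /ltW.
- by case: hpi => _ _ -> _; rewrite ltry.
Qed.

Lemma density_integral : \int[mu]_(x in D) pi x = 1.
Proof. by rewrite /Rintegral; case: hpi => _ _ -> _. Qed.

Lemma measurable_idD : measurable_fun D (@idfun R).
Proof. exact: measurable_id. Qed.

(** Finiteness of the second moment is the only integrability assumption, and
    quadratic growth is all that it has to cover. *)
Lemma quadratic_integrable (g : R -> R) (A : R) : measurable_fun D g ->
  (forall x, D x -> `|g x| <= A * (1 + x ^+ 2)) ->
  mu.-integrable D (EFin \o (fun x => g x * pi x)).
Proof.
move=> mg gA.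
have isq : mu.-integrable D (EFin \o (fun x => x ^+ 2 * pi x)).
  apply: ge0_integrable => //.
  - apply: measurable_funM; last exact: measurable_density.
    exact: measurable_funX measurable_idD.
  - by move=> x /density_gt0 /ltW p0; rewrite mulr_ge0// sqr_ge0.
  - by case: hpi.
have := integrableZl_EFin mD A (integrableD_EFin mD density_integrable isq).
apply: le_integrable_EFin => //.
  by apply: measurable_funM => //; exact: measurable_density.
move=> x Dx; have p0 := density_gt0 Dx.
rewrite normrM (gtr0_norm p0).
have -> : A * (pi x + x ^+ 2 * pi x) = A * (1 + x ^+ 2) * pi x by ring.
by rewrite ler_pM2r// gA.
Qed.

Lemma id_integrable : mu.-integrable D (EFin \o (fun x => x * pi x)).
Proof.
apply: (@quadratic_integrable idfun 1); first exact: measurable_idD.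
move=> x _ /=; rewrite ler_norml; nra.
Qed.

Lemma centered_integrable c : mu.-integrable D (EFin \o (fun x => (x - c) * pi x)).
Proof.
have := integrableB_EFin mD id_integrable (integrableZl_EFin mD c density_integrable).
by apply: eq_integrable => // x _ /=; rewrite mulrBl.
Qed.

Lemma centered_sqr_integrable c :
  mu.-integrable D (EFin \o (fun x => (x - c) ^+ 2 * pi x)).
Proof.
apply: (@quadratic_integrable _ (2 * (1 + c ^+ 2))).
  apply: measurable_funX; apply: measurable_funB; first exact: measurable_idD.
  exact: measurable_cst.
move=> x _; rewrite ger0_norm ?sqr_ge0//.
have := sqr_ge0 (x + c); have := sqr_ge0 (x * c); nra.
Qed.

Definition mean := \int[mu]_(x in D) (x * pi x).
Definition variance := \int[mu]_(x in D) ((x - mean) ^+ 2 * pi x).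

Lemma centered_integral c : \int[mu]_(x in D) ((x - c) * pi x) = mean - c.
Proof.
under eq_Rintegral do rewrite mulrBl.
rewrite RintegralB//; [|exact: id_integrable|].
  by rewrite RintegralZl//; [rewrite density_integral mulr1|exact: density_integrable].
by apply: integrableZl_EFin => //; exact: density_integrable.
Qed.

(** Strict positivity only has to hold on an interval, since intervals are not
    negligible. *)
Lemma Rintegral_open_gt0 (g : R -> R) (a b : R) :
  mu.-integrable D (EFin \o g) -> (forall x, D x -> 0 <= g x) ->
  D a -> D b -> a < b -> (forall x, a < x < b -> 0 < g x) ->
  0 < \int[mu]_(x in D) g x.
Proof.
move=> ig g0 Da Db ab gab; rewrite lt_neqAle Rintegral_ge0// andbT eq_sym.
apply/eqP => I0.
have /(ae_eq_integral_abs mu mD (measurable_int _ ig)) [N [mN N0 sub]] :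
    (\int[mu]_(x in D) `|(EFin \o g) x| = 0)%E.
  rewrite -[RHS](_ : (\int[mu]_(x in D) (g x)%:E)%E = _).
    by apply: eq_integral => x; rewrite inE => Dx; rewrite gee0_abs// lee_fin g0.
  by rewrite Rintegral_fineK// I0.
have sN : `]a, b[%classic `<=` N.
  move=> x; rewrite /= in_itv/= => axb; apply: sub => /=.
  have Dx : D x.
    by case/andP: axb => ax xb; apply: (open_itv_convex Da Db); rewrite !ltW.
  by move=> /(_ Dx) []; apply/eqP; rewrite gt_eqF// gab.
have : (mu `]a, b[ <= mu N)%E.
  by apply: le_measure => //; rewrite inE//; exact: measurable_itv.
rewrite N0 lebesgue_measure_itv/= lte_fin ab -EFinB lee_fin.
by rewrite leNgt subr_gt0 ab.
Qed.

Lemma open_itv_nonempty : exists x, D x.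
Proof.
apply: contrapT => nD; have := density_integral.
have -> : D = set0 by apply/seteqP; split => // x Dx; apply: nD; exists x.
by rewrite Rintegral_set0 => /eqP; rewrite eq_sym oner_eq0.
Qed.

Lemma open_itv_between x : D x -> exists a b, [/\ D a, D b, a < x & x < b].
Proof.
move=> Dx; have /nbhs_ballP[e /= e0 sub] := near_open_itv Dx.
exists (x - e / 2), (x + e / 2); split; [| |lra|lra]; apply: sub; rewrite /ball/=.
  by rewrite opprB addrC subrK gtr0_norm; lra.
by rewrite opprD addrA subrr sub0r normrN gtr0_norm; lra.
Qed.

(** If the mean were not above [x1], the centered first moment would be the
    integral of a positive function instead of 0; likewise at [x2]. *)
Lemma mean_in : D mean.
Proof.
have [x Dx] := open_itv_nonempty; have [a [b [Da Db ax xb]]] := open_itv_between Dx.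
have pos c : (forall y, D y -> c < y) -> c < mean.
  move=> cD; rewrite -subr_gt0 -centered_integral.
  have ab : a < b by lra.
  apply: (Rintegral_open_gt0 (centered_integrable c) _ Da Db ab).
  - by move=> y Dy; rewrite ltW// mulr_gt0 ?density_gt0// subr_gt0 cD.
  - move=> y /andP[ay yb]; have Dy : D y.
      by apply: (open_itv_convex Da Db); rewrite !ltW.
    by rewrite mulr_gt0 ?density_gt0// subr_gt0 cD.
have neg c : (forall y, D y -> y < c) -> mean < c.
  move=> cD; rewrite -subr_lt0 -centered_integral -oppr_gt0 -mulN1r.
  rewrite -RintegralZl//; last exact: centered_integrable.
  have ab : a < b by lra.
  have ic := integrableZl_EFin mD (-1) (centered_integrable c).
  have p y : D y -> 0 < -1 * ((y - c) * pi y).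
    move=> Dy; rewrite mulN1r -mulNr mulr_gt0 ?density_gt0//.
    by rewrite oppr_gt0 subr_lt0 cD.
  apply: (Rintegral_open_gt0 ic _ Da Db ab).
  - by move=> y /p /ltW.
  - move=> y /andP[ay yb]; apply: p.
    by apply: (open_itv_convex Da Db); rewrite !ltW.
split.
- case E : x1 => [r| |].
  + by rewrite lte_fin; apply: pos => y [+ _]; rewrite E lte_fin.
  + by case: Dx; rewrite E.
  + exact: ltNyr.
- case E : x2 => [r| |].
  + by rewrite lte_fin; apply: neg => y [_]; rewrite E lte_fin.
  + exact: ltry.
  + by case: Dx; rewrite E.
Qed.

Lemma variance_gt0 : 0 < variance.
Proof.
have [a [b [Da Db am mb]]] := open_itv_between mean_in.
apply: (Rintegral_open_gt0 (centered_sqr_integrable mean) _ mean_in Db mb).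
- by move=> y /density_gt0 /ltW p0; rewrite mulr_ge0// sqr_ge0.
- move=> y /andP[ay yb]; rewrite mulr_gt0//.
    by rewrite exprn_gt0// subr_gt0.
  by apply: density_gt0; apply: (open_itv_convex mean_in Db); rewrite !ltW.
Qed.

(** The second moment about [c] exceeds the variance by (mean - c)^2. *)
Lemma variance_le c : variance <= \int[mu]_(x in D) ((x - c) ^+ 2 * pi x).
Proof.
have i1 := centered_sqr_integrable mean.
have i2 := integrableZl_EFin mD (2 * (mean - c)) (centered_integrable mean).
have i3 := integrableZl_EFin mD ((mean - c) ^+ 2) density_integrable.
have -> : \int[mu]_(x in D) ((x - c) ^+ 2 * pi x) =
    \int[mu]_(x in D) ((x - mean) ^+ 2 * pi x
      + 2 * (mean - c) * ((x - mean) * pi x) + (mean - c) ^+ 2 * pi x).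
  by apply: eq_Rintegral => x _; ring.
rewrite RintegralD//; last exact: integrableD_EFin.
rewrite RintegralD// RintegralZl//; last exact: centered_integrable.
rewrite RintegralZl ?density_integral//; last exact: density_integrable.
by rewrite centered_integral subrr mulr0 addr0 mulr1 lerDl sqr_ge0.
Qed.

End density.

(** * The Stein kernel *)

Section stein_kernel.
Context {R : realType}.
Variables (x1 x2 : \bar R) (pi : R -> R).
Hypothesis hpi : stationary_density x1 x2 pi.
Local Notation D := (open_itv x1 x2).
Local Notation mu := (@lebesgue_measure R).
Local Notation m := (mean x1 x2 pi).
Let mD : measurable (D : set (measurableTypeR R)) := @measurable_open_itv R x1 x2.

(** The integral of (m - y) pi(y) from [x1] to [t], with the range of
    integration encoded by the truth value of [y <= t]. *)
Definition stein_kernel (t : R) :=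
  \int[mu]_(y in D) ((y <= t)%R%:R * ((m - y) * pi y)).

Lemma cut_integrable (b : R -> bool) (f : R -> R) : measurable_fun D b ->
  mu.-integrable D (EFin \o f) ->
  mu.-integrable D (EFin \o (fun y => (b y)%:R * f y)).
Proof.
move=> mb fi; have := integrable_norm fi; apply: le_integrable_EFin => //.
  apply: measurable_funM; first exact: measurable_fun_boolR.
  by apply/measurable_EFinP; exact: measurable_int fi.
by move=> x _; case: (b x); rewrite /= ?mul1r ?mul0r ?normr0.
Qed.

Lemma measurable_le_cst (t : R) : measurable_fun D (fun y : R => y <= t).
Proof. by apply: measurable_fun_ler; [exact: measurable_idD|exact: measurable_cst]. Qed.

Lemma measurable_cst_lt (t : R) : measurable_fun D (fun y : R => t < y).
Proof. by apply: measurable_fun_ltr; [exact: measurable_cst|exact: measurable_idD]. Qed.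

Lemma centeredN_integrable c : mu.-integrable D (EFin \o (fun y => (c - y) * pi y)).
Proof.
have := integrableZl_EFin mD (-1) (centered_integrable hpi c).
by apply: eq_integrable => // x _; rewrite /= mulrA mulN1r opprB.
Qed.

(** The centered first moment is 0, so the integral up to [t] is the opposite
    of the integral beyond [t]. *)
Lemma stein_kernel_upper t :
  stein_kernel t = \int[mu]_(y in D) ((t < y)%R%:R * ((y - m) * pi y)).
Proof.
have i1 := cut_integrable (measurable_le_cst t) (centeredN_integrable m).
have i2 := cut_integrable (measurable_cst_lt t) (centered_integrable hpi m).
apply/eqP; rewrite -subr_eq0 /stein_kernel -RintegralB//.
have -> : 0 = -1 * (m - m) by rewrite subrr mulr0.
rewrite -[X in -1 * X](centered_integral hpi) -RintegralZl//; last exact: centered_integrable.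
apply/eqP; apply: eq_Rintegral => y _.
by case: leP => _ /=; ring.
Qed.

(** [t] separates [c] and [y]; half-open on the side that makes
    [stein_kernel_between] exact even at [t = c]. *)
Definition between (c t y : R) := (c <= t < y) || (y <= t < c).

Lemma between_ge c t y : c <= y -> between c t y = (c <= t < y).
Proof.
move=> cy; rewrite /between; case: (boolP (c <= t < y)) => //= _; apply/negbTE/negP.
by move=> /andP[yt tc]; move: (le_lt_trans yt tc); rewrite ltNge cy.
Qed.

Lemma between_le c t y : y <= c -> between c t y = (y <= t < c).
Proof. by move=> yc; rewrite -(between_ge t yc) /between orbC. Qed.

(** Combines the two formulas for the kernel into a single one with a
    nonnegative integrand, which Tonelli's theorem requires. *)
Lemma stein_kernel_between t :
  stein_kernel t = \int[mu]_(y in D) ((between m t y)%:R * (`|y - m| * pi y)).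
Proof.
have [mt|tm] := leP m t.
- rewrite stein_kernel_upper; apply: eq_Rintegral => y _.
  rewrite /between (ltNge t m) mt /= andbF orbF; have [ty|] := ltP t y; last by rewrite !mul0r.
  by rewrite ger0_norm// subr_ge0 (le_trans mt)// ltW.
- apply: eq_Rintegral => y _.
  rewrite /between (leNgt m t) tm /= andbT; have [ty|] := leP y t; last by rewrite !mul0r.
  by rewrite distrC ger0_norm// subr_ge0 (le_trans ty)// ltW.
Qed.

Lemma stein_kernel_gt0 t : D t -> 0 < stein_kernel t.
Proof.
move=> Dt; have [a [b [Da Db ta tb]]] := open_itv_between Dt.
have [mt|tm] := leP m t.
- rewrite stein_kernel_upper.
  apply: (Rintegral_open_gt0 _ _ Dt Db tb).
  + exact: cut_integrable (measurable_cst_lt t) (centered_integrable hpi m).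
  + move=> y /(density_gt0 hpi)/ltW p0; have [ty|] := ltP t y; last by rewrite mul0r.
    by rewrite mul1r mulr_ge0// subr_ge0 (le_trans mt)// ltW.
  + move=> y /andP[ty yb]; rewrite ty mul1r mulr_gt0//.
      by rewrite subr_gt0 (le_lt_trans mt).
    by apply: (density_gt0 hpi); apply: (open_itv_convex Dt Db); rewrite !ltW.
- rewrite /stein_kernel.
  apply: (Rintegral_open_gt0 _ _ Da Dt ta).
  + exact: cut_integrable (measurable_le_cst t) (centeredN_integrable m).
  + move=> y /(density_gt0 hpi)/ltW p0; have [ty|] := leP y t; last by rewrite mul0r.
    by rewrite mul1r mulr_ge0// subr_ge0 (le_trans ty)// ltW.
  + move=> y /andP[ay yt]; rewrite (ltW yt) mul1r mulr_gt0//.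
      by rewrite subr_gt0 (lt_trans yt).
    by apply: (density_gt0 hpi); apply: (open_itv_convex Da Dt); rewrite !ltW.
Qed.

(** The fundamental theorem of calculus for an integral from minus infinity,
    applied to the integrand extended by 0 outside the interval. *)
Lemma stein_kernel_derive t : D t ->
  derivable stein_kernel t 1 /\ derive1 stein_kernel t = (m - t) * pi t.
Proof.
move=> Dt; pose f := (fun y => (m - y) * pi y) \_ D.
have fi : mu.-integrable setT (EFin \o f).
  rewrite /f -restrict_EFin; apply/(integrable_mkcond _ mD).
  exact: centeredN_integrable.
have KE : stein_kernel = fun t => \int[mu]_(y in `]-oo, t]) f y.
  apply/funext => s; rewrite /stein_kernel [LHS]Rintegral_mkcond [RHS]Rintegral_mkcond.
  apply: eq_Rintegral => y _; rewrite /f !patchE.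
  have [yD|] := boolP (y \in D); last by case: ifP.
  have [ys|ys] := leP y s; first by rewrite mul1r mem_set//= in_itv.
  by rewrite mul0r memNset//= in_itv/=; apply/negP; rewrite -ltNge.
have ft : f t = (m - t) * pi t by rewrite /f patchE mem_set.
rewrite KE -ft; apply: (@continuous_FTC1 R f -oo%O t (t + 1)).
- by rewrite ltrDl.
- by apply: integrableS fi => //; exact: measurable_itv.
- exact: ltNyr.
- have : {for t, continuous (fun y => (m - y) * pi y)}.
    apply: cvgM; last by case: hpi => + _ _ _; apply; rewrite inE.
    by apply: cvgB; [exact: cvg_cst|exact: cvg_id].
  rewrite /prop_for /continuous_at ft; apply: cvg_trans; apply: near_eq_cvg.
  near=> y; rewrite /f patchE mem_set//.
  by near: y; exact: near_open_itv.
Unshelve. all: by end_near. Qed.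

(** Before [a] the kernel is an integral over a part of ]x1, a[, and after
    [b], by [stein_kernel_upper], one over a part of ]b, x2[; both are small
    by tightness. *)
Lemma stein_kernel_small e : 0 < e -> exists a b, [/\ D a, D b,
  forall t, t < a -> `|stein_kernel t| <= e &
  forall t, b < t -> `|stein_kernel t| <= e].
Proof.
move=> e0.
have [a [b [Da Db am mb small]]] := integrable_tight (centered_integrable hpi m) (mean_in hpi) e0.
have iab : mu.-integrable D (EFin \o
    (fun y => (~~ (a <= y <= b))%:R * `|(y - m) * pi y|)).
  apply: cut_integrable; last exact: (integrable_norm (centered_integrable hpi m)).
  apply: measurable_neg; apply: measurable_and; last exact: measurable_le_cst.
  by apply: measurable_fun_ler; [exact: measurable_cst|exact: measurable_idD].
exists a, b; split => // t ht; apply: le_trans small.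
- have i1 := cut_integrable (measurable_le_cst t) (centeredN_integrable m).
  rewrite /stein_kernel (le_trans (le_normr_Rintegral _ i1))//.
  apply: le_Rintegral => //; first exact: (integrable_norm i1).
  move=> y Dy; have [yt|_] := leP y t; last by rewrite mul0r normr0 mulr_ge0.
  have -> : (a <= y) = false by apply/negbTE; rewrite -ltNge; exact: le_lt_trans ht.
  by rewrite !mul1r !normrM distrC.
- have i1 := cut_integrable (measurable_cst_lt t) (centered_integrable hpi m).
  rewrite stein_kernel_upper (le_trans (le_normr_Rintegral _ i1))//.
  apply: le_Rintegral => //; first exact: (integrable_norm i1).
  move=> y Dy; have [yt|_] := ltP t y; last by rewrite mul0r normr0 mulr_ge0.
  have -> : (y <= b) = false by apply/negbTE; rewrite -ltNge; exact: lt_trans yt.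
  by rewrite andbF !mul1r !normrM.
Qed.

Lemma stein_kernel_lower_end : stein_kernel @ lower_end x1 --> 0.
Proof.
apply/cvgr0Pnorm_le => e e0; have [a [b [Da Db sa _]]] := stein_kernel_small e0.
by have := near_lower_end Da; apply: filterS => t [/sa].
Qed.

Lemma stein_kernel_upper_end : stein_kernel @ upper_end x2 --> 0.
Proof.
apply/cvgr0Pnorm_le => e e0; have [a [b [Da Db _ sb]]] := stein_kernel_small e0.
by have := near_upper_end Db; apply: filterS => t [/sb].
Qed.

End stein_kernel.

(** * The Poincare inequality for the Stein kernel *)

Section poincare.
Context {R : realType}.
Variables (x1 x2 : \bar R) (pi : R -> R).
Hypothesis hpi : stationary_density x1 x2 pi.
Local Notation D := (open_itv x1 x2).
Local Notation mu := (@lebesgue_measure R).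
Local Notation m := (mean x1 x2 pi).
Local Notation K := (stein_kernel x1 x2 pi).
Let mD : measurable (D : set (measurableTypeR R)) := @measurable_open_itv R x1 x2.

Section swap.
Variable q : R -> R.
Hypothesis mq : measurable_fun D q.
Hypothesis q0 : forall x, D x -> 0 <= q x.

Let J x := (\int[mu]_(t in D) ((between m t x)%:R * q t)%:E)%E.

Let qD0 t : 0 <= (q \_ D) t.
Proof. by rewrite patchE; case: ifPn => //; rewrite inE => /q0. Qed.

Let mqD : measurable_fun setT (q \_ D).
Proof. exact/(measurable_restrictT _ mD). Qed.

Let measurable_between :
  measurable_fun setT (fun z : R * R => (between m z.2 z.1)%:R : R).
Proof.
apply: measurable_fun_boolR; apply: measurable_or; apply: measurable_and.
- by apply: measurable_fun_ler; [exact: measurable_cst|exact: measurable_snd].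
- by apply: measurable_fun_ltr; [exact: measurable_snd|exact: measurable_fst].
- by apply: measurable_fun_ler; [exact: measurable_fst|exact: measurable_snd].
- by apply: measurable_fun_ltr; [exact: measurable_snd|exact: measurable_cst].
Qed.

Let patch_in (f : R -> R) y : y \in D -> (f \_ D) y = f y.
Proof. by rewrite patchE => ->. Qed.

Let JE x : J x = (\int[mu]_t ((between m t x)%:R * (q \_ D) t)%:E)%E.
Proof.
rewrite /J integral_mkcond; apply: eq_integral => t _; rewrite !patchE.
by case: ifPn => //; rewrite mulr0.
Qed.

(** Measurability of the inner integral comes from Tonelli's theorem; it is
    needed to compare integrals in [stein_poincare]. *)
Lemma measurable_between_integral :
  measurable_fun D (fun x => ((`|x - m| * pi x)%:E * J x)%E).
Proof.
apply: emeasurable_funM.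
  apply/measurable_EFinP; apply: measurable_funM; last exact: measurable_density.
  apply: measurableT_comp => //.
  by apply: measurable_funB; [exact: measurable_idD|exact: measurable_cst].
rewrite (_ : J = fubini_F mu (fun z => ((between m z.2 z.1)%:R * (q \_ D) z.2)%:E)).
  apply: measurable_funTS; apply: measurable_fun_fubini_tonelli_F.
    apply/measurable_EFinP; apply: measurable_funM; first exact: measurable_between.
    by apply: measurableT_comp => //; exact: measurable_snd.
  by move=> z; rewrite lee_fin mulr_ge0.
by apply/funext => x; rewrite JE.
Qed.

(** Tonelli's theorem for the function |x - m| pi(x) q(t) on the pairs (x, t)
    such that [t] lies between [m] and [x]; at fixed [t], the integral in [x]
    is [stein_kernel_between]. *)
Lemma stein_kernel_swap :
  (\int[mu]_(x in D) ((`|x - m| * pi x)%:E * J x) =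
   \int[mu]_(t in D) (q t * K t)%:E)%E.
Proof.
have p0 y : 0 <= (pi \_ D) y.
  by rewrite patchE; case: ifPn => //; rewrite inE => /(density_gt0 hpi)/ltW.
have mpD : measurable_fun setT (pi \_ D).
  by apply/(measurable_restrictT _ mD); exact: measurable_density.
pose F (z : R * R) :=
  ((`|z.1 - m| * (pi \_ D) z.1) * ((between m z.2 z.1)%:R * (q \_ D) z.2))%:E.
have F0 z : (0 <= F z)%E by rewrite lee_fin !mulr_ge0.
have mF : measurable_fun setT F.
  apply/measurable_EFinP; apply: measurable_funM; apply: measurable_funM.
  - apply: measurableT_comp => //; apply: measurable_funB; first exact: measurable_fst.
    exact: measurable_cst.
  - by apply: measurableT_comp => //; exact: measurable_fst.
  - exact: measurable_between.
  - by apply: measurableT_comp => //; exact: measurable_snd.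
transitivity (\int[mu]_x \int[mu]_t F (x, t))%E.
  rewrite [LHS]integral_mkcond; apply: eq_integral => x _.
  rewrite patchE; case: ifPn => xD.
    rewrite JE -ge0_integralZl_EFin//; last 3 first.
    - by move=> t _; rewrite lee_fin mulr_ge0.
    - apply/measurable_EFinP; apply: measurable_funM => //.
      exact: (measurableT_comp measurable_between (measurable_pair1 x)).
    - by rewrite mulr_ge0// ltW// (density_gt0 hpi)//; exact: set_mem.
    by apply: eq_integral => t _; rewrite /F/= (patch_in pi xD) -EFinM.
  symmetry; apply: integral0_eq => t _.
  by rewrite /F/= patchE (negbTE xD) mulr0 mul0r.
rewrite (@fubini_tonelli _ _ _ _ _ mu mu F mF F0).
rewrite [RHS]integral_mkcond; apply: eq_integral => t _.
rewrite [RHS]patchE; case: ifPn => tD; last first.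
  by apply: integral0_eq => y _; rewrite /F/= [in X in _ * X]patchE (negbTE tD) !mulr0.
have mb : measurable_fun D (fun y => between m t y).
  apply: measurable_or; apply: measurable_and; try exact: measurable_cst.
  - exact: measurable_cst_lt.
  - exact: measurable_le_cst.
have ib : mu.-integrable D (EFin \o (fun y => (between m t y)%:R * (`|y - m| * pi y))).
  apply: cut_integrable => //.
  have := integrable_norm (centered_integrable hpi m); apply: eq_integrable => //.
  move=> y; rewrite inE => /(density_gt0 hpi) py.
  by rewrite /= normrM (gtr0_norm py).
rewrite (stein_kernel_between hpi) EFinM -Rintegral_fineK//.
rewrite -ge0_integralZl_EFin//; last 3 first.
- move=> y /(density_gt0 hpi)/ltW py.
  by rewrite lee_fin mulr_ge0// mulr_ge0.
- exact: measurable_int ib.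
- by apply: q0; exact: set_mem.
rewrite [RHS]integral_mkcond; apply: eq_integral => y _.
rewrite [RHS]patchE; case: ifPn => yD.
  by rewrite /F/= !patch_in// -EFinM; congr EFin; ring.
by rewrite /F/= [X in _ * X * _]patchE (negbTE yD) mulr0 mul0r.
Qed.

End swap.

End poincare.

Section poincare_ineq.
Context {R : realType}.
Variables (x1 x2 : \bar R) (pi : R -> R).
Hypothesis hpi : stationary_density x1 x2 pi.
Local Notation D := (open_itv x1 x2).
Local Notation mu := (@lebesgue_measure R).
Local Notation m := (mean x1 x2 pi).
Local Notation K := (stein_kernel x1 x2 pi).
Let mD : measurable (D : set (measurableTypeR R)) := @measurable_open_itv R x1 x2.
Variable Q : R -> R.
Hypothesis dQ : cont_diff_on D Q.

Lemma between_Rintegral (a b : R) : D a -> D b ->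
  (\int[mu]_(t in D) ((a <= t < b)%R%:R * derive1 Q t ^+ 2)%:E =
   (\int[mu]_(t in `[a, b]) (derive1 Q t ^+ 2))%:E)%E.
Proof.
move=> Da Db; have iq := itv_integrable (derive1_sqr_continuous dQ) Da Db.
rewrite -Rintegral_fineK; [|exact: measurable_itv|exact: iq].
rewrite -integral_itv_bndo_bndc; last first.
  have := measurable_int _ iq; apply: measurable_funS.
    exact: measurable_itv.
  by apply: subset_itvl; rewrite bnd_simp.
have <- : D `&` `[a, b[ = `[a, b[.
  apply: setIidr => t; rewrite /= in_itv/= => /andP[at_ tb].
  by apply: (open_itv_convex Da Db); rewrite at_ ltW.
rewrite [RHS]integral_mkcondr; apply: eq_integral => t _.
rewrite patchE mem_setE in_itv/=.
by case: ifP => _; rewrite ?mul1r ?mul0r.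
Qed.

Lemma increment_sqr_between x : D x ->
  (((Q x - Q m) ^+ 2)%:E <= (`|x - m|)%:E *
    \int[mu]_(t in D) ((between m t x)%:R * derive1 Q t ^+ 2)%:E)%E.
Proof.
move=> Dx; have Dm := mean_in hpi.
have [mx|xm] := leP m x.
- under eq_integral => t _ do rewrite (between_ge _ mx).
  rewrite between_Rintegral// ger0_norm ?subr_ge0// -EFinM lee_fin.
  exact: (increment_sqr_le dQ Dm Dx mx).
- under eq_integral => t _ do rewrite (between_le _ (ltW xm)).
  rewrite between_Rintegral// distrC (gtr0_norm (_ : 0 < m - x)) ?subr_gt0// -EFinM lee_fin.
  by rewrite -sqrrN opprB; exact: (increment_sqr_le dQ Dx Dm (ltW xm)).
Qed.

(** A Poincare inequality with centre [Q m] instead of the mean of [Q], which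
    makes the one-variable bound [increment_sqr_between] sufficient. *)
Lemma stein_poincare :
  (\int[mu]_(x in D) (pi x * (Q x - Q m) ^+ 2)%:E <=
   \int[mu]_(x in D) (derive1 Q x ^+ 2 * K x)%:E)%E.
Proof.
have mQ : measurable_fun D Q.
  by apply: measurable_open_itv_continuous; exact: cont_diff_continuous.
have mq : measurable_fun D (fun x => derive1 Q x ^+ 2).
  by apply: measurable_open_itv_continuous; exact: derive1_sqr_continuous.
have q0 x : D x -> 0 <= derive1 Q x ^+ 2 by move=> _; exact: sqr_ge0.
rewrite -(stein_kernel_swap hpi mq q0); apply: ge0_le_integral => //.
- by move=> x /(density_gt0 hpi)/ltW p0; rewrite lee_fin mulr_ge0// sqr_ge0.
- apply/measurable_EFinP; apply: measurable_funM; first exact: measurable_density.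
  apply: measurable_funX; apply: measurable_funB => //; exact: measurable_cst.
- exact: measurable_between_integral.
- move=> x Dx; rewrite [`|x - m| * pi x]mulrC !(EFinM (pi x)) -muleA.
  apply: lee_wpmul2l; first by rewrite lee_fin ltW// (density_gt0 hpi).
  exact: increment_sqr_between.
Qed.

(** For a function of mean 0 and norm 1, the integral of pi (Q - Q(m))^2 is 1
    + Q(m)^2. *)
Lemma trial_poincare :
  (\int[mu]_(x in D) (pi x * Q x ^+ 2)%:E = 1)%E ->
  (\int[mu]_(x in D) (pi x * Q x)%:E = 0)%E ->
  (1 <= \int[mu]_(x in D) (derive1 Q x ^+ 2 * K x)%:E)%E.
Proof.
move=> Q2 Q1; apply: le_trans stein_poincare.
have mQ : measurable_fun D Q.
  by apply: measurable_open_itv_continuous; exact: cont_diff_continuous.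
have mp := measurable_density hpi.
have ip := density_integrable hpi.
have i2 : mu.-integrable D (EFin \o (fun x => pi x * Q x ^+ 2)).
  apply: ge0_integrable => //.
  - by apply: measurable_funM => //; exact: measurable_funX.
  - by move=> x /(density_gt0 hpi)/ltW p0; rewrite mulr_ge0// sqr_ge0.
  - by rewrite Q2 ltry.
have i1 : mu.-integrable D (EFin \o (fun x => pi x * Q x)).
  have := integrableD_EFin mD ip i2; apply: le_integrable_EFin => //.
    exact: measurable_funM.
  move=> x /(density_gt0 hpi) p0; rewrite normrM gtr0_norm//.
  have -> : pi x + pi x * Q x ^+ 2 = pi x * (1 + Q x ^+ 2) by ring.
  rewrite ler_pM2l// ler_norml; nra.
have E2 : \int[mu]_(x in D) (pi x * Q x ^+ 2) = 1 by rewrite /Rintegral Q2.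
have E1 : \int[mu]_(x in D) (pi x * Q x) = 0 by rewrite /Rintegral Q1.
have i1c := integrableZl_EFin mD (2 * Q m) i1.
have ipc := integrableZl_EFin mD (Q m ^+ 2) ip.
have i21 := integrableB_EFin mD i2 i1c.
have -> : (\int[mu]_(x in D) (pi x * (Q x - Q m) ^+ 2)%:E =
   \int[mu]_(x in D) ((pi x * Q x ^+ 2 - 2 * Q m * (pi x * Q x)) + Q m ^+ 2 * pi x)%:E)%E.
  by apply: eq_integral => x _; congr EFin; ring.
rewrite Rintegral_fineK//; last exact: integrableD_EFin.
rewrite RintegralD// RintegralB// !RintegralZl// E1 E2 (density_integral hpi).
by rewrite lee_fin mulr0 subr0 mulr1 lerDl sqr_ge0.
Qed.

End poincare_ineq.

(** * The optimal variance function *)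

Section optimum.
Context {R : realType}.
Variables (x1 x2 : \bar R) (v : R) (pi : R -> R).
Hypothesis v0 : 0 < v.
Hypothesis hpi : stationary_density x1 x2 pi.
Local Notation D := (open_itv x1 x2).
Local Notation mu := (@lebesgue_measure R).
Local Notation m := (mean x1 x2 pi).
Local Notation V := (variance x1 x2 pi).
Local Notation K := (stein_kernel x1 x2 pi).
Let mD : measurable (D : set (measurableTypeR R)) := @measurable_open_itv R x1 x2.
Let V0 : 0 < V := variance_gt0 hpi.

Lemma is_derive_affine (c b x : R) : is_derive x 1 (fun y : R => (y - b) * c) c.
Proof. by apply: is_derive_eq; rewrite /GRing.scale/=; ring. Qed.

Lemma affine_derive1 (c b : R) : derive1 (fun x : R => (x - b) * c) = fun=> c.
Proof.
by apply/funext => x; rewrite derive1E; have [_ ->] := is_derive_affine c b x.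
Qed.

Lemma affine_cont_diff (c b : R) : cont_diff_on D (fun x : R => (x - b) * c).
Proof.
split; last by rewrite affine_derive1 => x _; exact: cvg_cst.
by move=> x _; have [] := is_derive_affine c b x.
Qed.

Lemma stein_kernel_continuous : {in D, continuous K}.
Proof.
move=> x; rewrite inE => Dx; apply: differentiable_continuous.
by apply/derivable1_diffP; exact: (stein_kernel_derive hpi Dx).1.
Qed.

Lemma measurable_stein_kernel : measurable_fun D K.
Proof. by apply: measurable_open_itv_continuous; exact: stein_kernel_continuous. Qed.

(** The case of equality of the Poincare inequality: [stein_kernel_swap] for
    the identity. *)
Lemma stein_kernel_integral : (\int[mu]_(t in D) (K t)%:E = V%:E)%E.
Proof.
pose Q (x : R) := (x - 0) * 1.
have dQ : cont_diff_on D Q := affine_cont_diff 1 0.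
have q1 : derive1 Q = fun=> 1 by exact: affine_derive1.
have mq : measurable_fun D (fun x => derive1 Q x ^+ 2).
  by rewrite q1; exact: measurable_cst.
have q0 x : D x -> 0 <= derive1 Q x ^+ 2 by move=> _; exact: sqr_ge0.
have := stein_kernel_swap hpi mq q0.
under [X in _ = X -> _]eq_integral do rewrite q1 expr1n mul1r.
move=> <-; rewrite -Rintegral_fineK//; last exact: centered_sqr_integrable.
apply: eq_integral => x; rewrite inE => Dx.
have -> : (\int[mu]_(t in D) ((between m t x)%:R * derive1 Q t ^+ 2)%:E = (`|x - m|)%:E)%E.
  have len (a b : R) : a <= b -> D a -> D b -> 
      (\int[mu]_(t in D) ((a <= t < b)%R%:R * derive1 Q t ^+ 2)%:E = (b - a)%:E)%E.
    move=> ab Da Db; rewrite (between_Rintegral dQ Da Db) q1 expr1n.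
    rewrite Rintegral_cst//=.
    rewrite lebesgue_measure_itv/= lte_fin mul1r.
    by move: ab; rewrite le_eqVlt => /predU1P[->|->]//; rewrite ltxx/= subrr.
  have Dm := mean_in hpi.
  have [mx|xm] := leP m x.
  - under eq_integral => t _ do rewrite (between_ge _ mx).
    by rewrite len// ger0_norm// subr_ge0.
  - under eq_integral => t _ do rewrite (between_le _ (ltW xm)).
    by rewrite len// ?ltW// distrC gtr0_norm// subr_gt0.
rewrite -EFinM; congr EFin; rewrite mulrAC -normrM -expr2 ger0_norm ?sqr_ge0//.
Qed.

(** Chosen so that half of sigma^2 pi is (v / V) K, which makes the centered
    identity an eigenfunction for v / V. *)
Definition optimal_s2 (x : R) := 2 * (v / V) * K x / pi x.

Lemma optimal_s2_density x : D x -> optimal_s2 x * pi x = 2 * (v / V) * K x.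
Proof. by move=> /(density_gt0 hpi) p0; rewrite /optimal_s2 mulfVK// gt_eqF. Qed.

Lemma optimal_half x : D x -> 2^-1 * optimal_s2 x * pi x = (v / V) * K x.
Proof. by move=> Dx; rewrite -mulrA optimal_s2_density//; field; rewrite gt_eqF. Qed.

(** On the interval sigma^2 pi is a multiple of [K], whose derivative (m - x)
    pi(x) is continuous because pi is. *)
Lemma optimal_cont_diff : cont_diff_on D (fun x => optimal_s2 x * pi x).
Proof.
pose c := 2 * (v / V).
have near_eq x : D x -> \forall y \near x, c * K y = optimal_s2 y * pi y.
  move=> Dx; have := near_open_itv Dx.
  by apply: filterS => y Dy; rewrite optimal_s2_density.
have dc x : D x -> derivable (fun y => c * K y) x 1.
  by move=> Dx; apply: derivableM => //; exact: (stein_kernel_derive hpi Dx).1.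
have dcE x : D x -> derive1 (fun y => optimal_s2 y * pi y) x = c * ((m - x) * pi x).
  move=> Dx; rewrite derive1E -(near_eq_derive _ (near_eq _ Dx)).
  rewrite deriveZ/=; last exact: (stein_kernel_derive hpi Dx).1.
  by rewrite -derive1E (stein_kernel_derive hpi Dx).2.
split; first by move=> x Dx; apply: near_eq_derivable (near_eq _ Dx) _; exact: dc.
move=> x; rewrite inE => Dx; rewrite /continuous_at dcE//.
have : (fun y => c * ((m - y) * pi y)) @ x --> c * ((m - x) * pi x).
  apply: cvgM; first exact: cvg_cst.
  apply: cvgM; last by case: hpi => + _ _ _; apply; rewrite inE.
  by apply: cvgB; [exact: cvg_cst|exact: cvg_id].
apply: cvg_trans; apply: near_eq_cvg; have := near_open_itv Dx.
by apply: filterS => y Dy; rewrite dcE.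
Qed.

Lemma optimal_energy (Q : R -> R) : cont_diff_on D Q ->
  energy x1 x2 pi optimal_s2 Q =
  ((v / V)%:E * \int[mu]_(x in D) (derive1 Q x ^+ 2 * K x)%:E)%E.
Proof.
move=> dQ; rewrite -ge0_integralZl_EFin//; last 3 first.
- by move=> x Dx; rewrite lee_fin mulr_ge0 ?sqr_ge0// ltW// (stein_kernel_gt0 hpi).
- apply/measurable_EFinP; apply: measurable_funM; last exact: measurable_stein_kernel.
  by apply: measurable_open_itv_continuous; exact: derive1_sqr_continuous.
- by rewrite divr_ge0// ltW.
apply: eq_integral => x; rewrite inE => Dx.
by rewrite optimal_half// -EFinM; congr EFin; ring.
Qed.

(** The lower bound on the energy is [trial_poincare]; the minimum is attained
    at the standardized identity (x - m) / sqrt V. *)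
Lemma optimal_is_lambda1 : is_lambda1 x1 x2 pi optimal_s2 (v / V).
Proof.
split; last first.
  move=> _ [Q [dQ Q2 Q1 _ _] <-]; rewrite optimal_energy//.
  rewrite -[X in (X <= _)%E]mule1; apply: lee_wpmul2l.
    by rewrite lee_fin divr_ge0// ltW.
  exact: trial_poincare.
pose c := (Num.sqrt V)^-1.
have c2 : c ^+ 2 = V^-1 by rewrite exprVn sqr_sqrtr// ltW.
pose Q (x : R) := (x - m) * c.
have dQ : cont_diff_on D Q := affine_cont_diff c m.
have q1 : derive1 Q = fun=> c by exact: affine_derive1.
have flux0 (F : set_system R) : Filter F -> K @ F --> 0 -> (\forall x \near F, D x) ->
    (fun x => 2^-1 * optimal_s2 x * pi x * derive1 Q x) @ F --> 0.
  move=> FF K0 FD.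
  have : (fun x => (v / V) * K x * c) @ F --> (v / V) * 0 * c.
    by apply: cvgMl; apply: cvgMr.
  rewrite mulr0 mul0r; apply: cvg_trans; apply: near_eq_cvg.
  by move: FD; apply: filterS => x Dx; rewrite optimal_half// q1.
exists Q; last first.
  rewrite optimal_energy// q1.
  under eq_integral do rewrite c2 EFinM.
  rewrite ge0_integralZl_EFin//; last 3 first.
  - by move=> x Dx; rewrite lee_fin ltW// (stein_kernel_gt0 hpi).
  - by apply/measurable_EFinP; exact: measurable_stein_kernel.
  - by rewrite invr_ge0 ltW.
  rewrite stein_kernel_integral -!EFinM; congr EFin.
  by rewrite mulVf ?mulr1// gt_eqF.
have [a [b [Da Db am mb]]] := open_itv_between (mean_in hpi).
split => //.
- under eq_integral => x _.
    rewrite (_ : pi x * Q x ^+ 2 = V^-1 * ((x - m) ^+ 2 * pi x)); last first.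
      by rewrite /Q exprMn c2; ring.
    over.
  rewrite Rintegral_fineK//; last first.
    by apply: integrableZl_EFin => //; exact: centered_sqr_integrable.
  rewrite RintegralZl//; last exact: centered_sqr_integrable.
  by rewrite -/(variance _ _ _) mulVf// gt_eqF.
- under eq_integral => x _.
    rewrite (_ : pi x * Q x = c * ((x - m) * pi x)); last by rewrite /Q; ring.
    over.
  rewrite Rintegral_fineK//; last first.
    by apply: integrableZl_EFin => //; exact: centered_integrable.
  rewrite RintegralZl//; last exact: centered_integrable.
  by rewrite centered_integral// subrr mulr0.
- apply: flux0; first exact: stein_kernel_lower_end.
  have := near_lower_end Da; apply: filterS => x [xa x1x]; split => //.
  by rewrite (lt_trans _ Da.2)// lte_fin.
- apply: flux0; first exact: stein_kernel_upper_end.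
  have := near_upper_end Da; apply: filterS => x [xa x1x]; split => //.
  by rewrite (lt_trans Da.1)// lte_fin.
Qed.

Lemma optimal_admissible : admissible x1 x2 v pi optimal_s2.
Proof.
split.
- move=> x Dx; rewrite divr_gt0 ?(density_gt0 hpi)// mulr_gt0 ?(stein_kernel_gt0 hpi)//.
  by rewrite mulr_gt0// divr_gt0.
- exact: optimal_cont_diff.
- have -> : (\int[mu]_(x in D) (2^-1 * optimal_s2 x * pi x)%:E =
      \int[mu]_(x in D) ((v / V)%:E * (K x)%:E))%E.
    by apply: eq_integral => x; rewrite inE => Dx; rewrite optimal_half.
  rewrite ge0_integralZl_EFin//.
  + by rewrite stein_kernel_integral -EFinM mulfVK// gt_eqF.
  + by move=> x Dx; rewrite lee_fin ltW// (stein_kernel_gt0 hpi).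
  + by apply/measurable_EFinP; exact: measurable_stein_kernel.
  + by rewrite divr_ge0// ltW.
- by exists (v / V); exact: optimal_is_lambda1.
Qed.

End optimum.

(** * Upper bound on the convergence rate *)

Section upper_bound.
Context {R : realType}.
Variables (x1 x2 : \bar R) (v : R) (pi : R -> R).
Hypothesis v0 : 0 < v.
Hypothesis hpi : stationary_density x1 x2 pi.
Local Notation D := (open_itv x1 x2).
Local Notation mu := (@lebesgue_measure R).
Local Notation m := (mean x1 x2 pi).
Local Notation V := (variance x1 x2 pi).
Let mD : measurable (D : set (measurableTypeR R)) := @measurable_open_itv R x1 x2.
Let V0 : 0 < V := variance_gt0 hpi.

(** A trial function before scaling, close to the identity in L^2(pi): the
    clamp [Q] differs from the identity by at most |x - m|, and only where
    tightness makes (x - m)^2 small. [M] and [S] are the mean and the variance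
    of [Q]. With h = Q - x, passing from the second moment of x - m to that of
    Q - m loses at most [e], and so does subtracting the square of the mean of
    Q - m, which is the mean of h. *)
Lemma clamp_trial (e : R) : 0 < e -> 2 * e < V -> exists (Q q : R -> R) (M S : R),
  [/\ forall x : R, is_derive x 1 Q (q x), continuous q, forall x : R, 0 <= q x <= 1,
   (exists a b, [/\ D a, D b & forall x, x <= a \/ b <= x -> q x = 0]) &
   [/\ V - 2 * e <= S,
     mu.-integrable D (EFin \o (fun x => (Q x - M) * pi x)),
     mu.-integrable D (EFin \o (fun x => (Q x - M) ^+ 2 * pi x)),
     \int[mu]_(x in D) ((Q x - M) * pi x) = 0 &
     \int[mu]_(x in D) ((Q x - M) ^+ 2 * pi x) = S] ].
Proof.
move=> e0 eV.
have iu := centered_integrable hpi m; have iu2 := centered_sqr_integrable hpi m.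
have ip := density_integrable hpi; have mp := measurable_density hpi.
have [a [b [Da Db am mb small]]] := integrable_tight iu2 (mean_in hpi) e0.
have [a' [_ [Da' _ a'a _]]] := open_itv_between Da.
have [_ [b' [_ Db' _ bb']]] := open_itv_between Db.
pose d := Num.min (a - a') (b' - b).
have d0 : 0 < d by rewrite lt_min !subr_gt0 a'a.
have da : d <= a - a' by rewrite ge_min lexx.
have db : d <= b' - b by rewrite ge_min lexx orbT.
have [Q [q [dQ cq q01 qout [Qid Qx]]]] := smooth_clamp (le_trans am mb) d0.
have amb : a <= m <= b by rewrite am mb.
pose h x := Q x - x.
have hm x : `|h x| <= `|x - m| by exact: Qx.
have h0 x : a <= x <= b -> h x = 0 by move=> axb; rewrite /h Qid// subrr.
have mQ : measurable_fun D Q.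
  apply: measurable_open_itv_continuous => x _; apply: differentiable_continuous.
  by apply/derivable1_diffP; have [] := dQ x.
have mh : measurable_fun D h by apply: measurable_funB => //; exact: measurable_idD.
have mid : measurable_fun D (fun x : R => x - m).
  by apply: measurable_funB; [exact: measurable_idD|exact: measurable_cst].
have mw : measurable_fun D (fun x => Q x - m).
  by apply: measurable_funB; [exact: mQ|exact: measurable_cst].
have ih : mu.-integrable D (EFin \o (fun x => h x * pi x)).
  have := integrable_norm iu; apply: le_integrable_EFin => //.
    exact: measurable_funM.
  by move=> x Dx; rewrite /= !normrM ler_wpM2r.
have h2 x : h x ^+ 2 <= (x - m) ^+ 2.
  rewrite -[h x ^+ 2]real_normK ?num_real// -[_ ^+ 2 in leRHS]real_normK ?num_real//.
  by rewrite lerXn2r ?nnegrE.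
have ih2 : mu.-integrable D (EFin \o (fun x => h x ^+ 2 * pi x)).
  have := iu2; apply: le_integrable_EFin => //.
    by apply: measurable_funM => //; exact: measurable_funX.
  move=> x /(density_gt0 hpi) p0; rewrite normrM (gtr0_norm p0) ler_pM2r//.
  by rewrite ger0_norm ?sqr_ge0.
pose cut x := (~~ (a <= x <= b))%:R * `|(x - m) ^+ 2 * pi x|.
have icut : mu.-integrable D (EFin \o cut).
  apply: cut_integrable; last exact: (integrable_norm iu2).
  apply: measurable_neg; apply: measurable_and; last exact: measurable_le_cst.
  by apply: measurable_fun_ler; [exact: measurable_cst|exact: measurable_idD].
have cutE x : D x -> cut x = (~~ (a <= x <= b))%:R * ((x - m) ^+ 2 * pi x).
  move=> /(density_gt0 hpi)/ltW p0; rewrite /cut ger0_norm//.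
  by rewrite mulr_ge0// sqr_ge0.
pose A := \int[mu]_(x in D) (h x * pi x).
pose H2 := \int[mu]_(x in D) (h x ^+ 2 * pi x).
have H2e : H2 <= e.
  apply: le_trans small; apply: le_Rintegral => // x Dx.
  rewrite -/(cut x) cutE//; have p0 := density_gt0 hpi Dx.
  case: (boolP (a <= x <= b)) => xab /=; first by rewrite h0// expr0n/= !mul0r.
  by rewrite mul1r ler_pM2r.
have iAh := integrableZl_EFin mD (2 * A) ih.
have iAp := integrableZl_EFin mD (A ^+ 2) ip.
have A2 : A ^+ 2 <= H2.
  have : 0 <= \int[mu]_(x in D) (h x ^+ 2 * pi x - 2 * A * (h x * pi x) + A ^+ 2 * pi x).
    apply: Rintegral_ge0 => x /(density_gt0 hpi)/ltW p0.
    rewrite (_ : _ + _ = (h x - A) ^+ 2 * pi x); last by ring.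
    by rewrite mulr_ge0// sqr_ge0.
  rewrite RintegralD//; last exact: integrableB_EFin.
  rewrite RintegralB// !RintegralZl// (density_integral hpi) -/A -/H2; lra.
have iw : mu.-integrable D (EFin \o (fun x => (Q x - m) * pi x)).
  have := integrableD_EFin mD iu ih; apply: eq_integrable => // x _.
  by rewrite /= /h; congr EFin; ring.
have iw2 : mu.-integrable D (EFin \o (fun x => (Q x - m) ^+ 2 * pi x)).
  (* With u = x - m, (h + u)^2 <= 2 h^2 + 2 u^2 <= 4 u^2. *)
  have := integrableZl_EFin mD 4 iu2; apply: le_integrable_EFin => //.
    by apply: measurable_funM => //; exact: measurable_funX.
  move=> x /(density_gt0 hpi) p0; rewrite normrM (gtr0_norm p0) mulrA ler_pM2r//.
  rewrite ger0_norm ?sqr_ge0//.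
  have -> : Q x - m = h x + (x - m) by rewrite /h; ring.
  by have := h2 x; have := sqr_ge0 (h x - (x - m)); lra.
pose B := \int[mu]_(x in D) ((Q x - m) ^+ 2 * pi x).
have wA : \int[mu]_(x in D) ((Q x - m) * pi x) = A.
  have -> : \int[mu]_(x in D) ((Q x - m) * pi x) =
     \int[mu]_(x in D) ((x - m) * pi x + h x * pi x).
    by apply: eq_Rintegral => x _; rewrite /h; ring.
  by rewrite RintegralD// centered_integral// subrr add0r.
have BV : V - e <= B.
  have : V - \int[mu]_(x in D) cut x <= B.
    rewrite /variance -RintegralB//; apply: le_Rintegral => //.
      exact: integrableB_EFin.
    move=> x Dx; rewrite cutE//; have p0 := density_gt0 hpi Dx.
    case: (boolP (a <= x <= b)) => xab /=; first by rewrite mul0r subr0 Qid.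
    by rewrite mul1r subrr mulr_ge0 ?sqr_ge0// ltW.
  by apply: le_trans; rewrite lerB.
have iAw := integrableZl_EFin mD (2 * A) iw.
have iA1 := integrableZl_EFin mD A ip.
exists Q, q, (m + A), (B - A ^+ 2); split => //.
  exists a', b'; split => // x [xa|xb]; apply: qout; [left|right]; lra.
split.
- lra.
- have := integrableB_EFin mD iw iA1; apply: eq_integrable => // x _.
  by congr EFin; ring.
- have := integrableD_EFin mD (integrableB_EFin mD iw2 iAw) iAp.
  by apply: eq_integrable => // x _; congr EFin; ring.
- have -> : \int[mu]_(x in D) ((Q x - (m + A)) * pi x) =
     \int[mu]_(x in D) ((Q x - m) * pi x - A * pi x).
    by apply: eq_Rintegral => x _; ring.
  by rewrite RintegralB// RintegralZl// wA (density_integral hpi) mulr1 subrr.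
- have -> : \int[mu]_(x in D) ((Q x - (m + A)) ^+ 2 * pi x) =
     \int[mu]_(x in D) ((Q x - m) ^+ 2 * pi x - 2 * A * ((Q x - m) * pi x) + A ^+ 2 * pi x).
    by apply: eq_Rintegral => x _; ring.
  rewrite RintegralD//; last exact: integrableB_EFin.
  rewrite RintegralB// !RintegralZl// wA (density_integral hpi) -/B; ring.
Qed.

End upper_bound.

(** * The optimal relaxation time *)

Section maximal_rate.
Context {R : realType}.
Variables (x1 x2 : \bar R) (v : R) (pi : R -> R).
Hypothesis v0 : 0 < v.
Hypothesis hpi : stationary_density x1 x2 pi.
Local Notation D := (open_itv x1 x2).
Local Notation mu := (@lebesgue_measure R).
Local Notation V := (variance x1 x2 pi).
Let mD : measurable (D : set (measurableTypeR R)) := @measurable_open_itv R x1 x2.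
Let V0 : 0 < V := variance_gt0 hpi.

(** The scaled clamp is a trial function of energy at most v / S, because its
    slope before scaling lies in [0, 1]. *)
Lemma lambda1_clamp_le (s2 : R -> R) (l e : R) : admissible x1 x2 v pi s2 ->
  is_lambda1 x1 x2 pi s2 l -> 0 < e -> 2 * e < V -> l * (V - 2 * e) <= v.
Proof.
move=> [s20 ds2 s2v _] [[Q0 _ El] minl] e0 eV.
have g0 x : D x -> 0 <= 2^-1 * s2 x * pi x.
  by move=> Dx; have := density_gt0 hpi Dx; have := s20 _ Dx => ? ?; rewrite ltW// !mulr_gt0.
have l0 : 0 <= l.
  rewrite -lee_fin -El; apply: integral_ge0 => x Dx; rewrite lee_fin.
  by rewrite mulr_ge0 ?sqr_ge0// g0.
have [Q [q [M [S [dQ cq q01 [a [b [Da Db q0]]] [SV i1 i2 I1 I2]]]]]] :=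
  clamp_trial hpi e0 eV.
have S0 : 0 < S by lra.
pose c := (Num.sqrt S)^-1.
have c2 : c ^+ 2 = S^-1 by rewrite exprVn sqr_sqrtr// ltW.
pose T (x : R) := (Q x - M) * c.
have dT x : is_derive x (1 : R) T (q x * c).
  have := dQ x => ?; apply: is_derive_eq; rewrite /GRing.scale/=; ring.
have T1 : derive1 T = fun x => q x * c.
  by apply/funext => x; rewrite derive1E; have [_ ->] := dT x.
have trialT : trial_function x1 x2 pi s2 T.
  split.
  - split; first by move=> x _; have [] := dT x.
    by rewrite T1 => x _; apply: cvgMl; exact: cq.
  - have -> : (\int[mu]_(x in D) (pi x * T x ^+ 2)%:E =
        \int[mu]_(x in D) (S^-1 * ((Q x - M) ^+ 2 * pi x))%:E)%E.
      by apply: eq_integral => x _; rewrite /T exprMn c2; congr EFin; ring.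
    rewrite Rintegral_fineK//; last exact: integrableZl_EFin.
    by rewrite RintegralZl// I2 mulVf// gt_eqF.
  - have -> : (\int[mu]_(x in D) (pi x * T x)%:E =
        \int[mu]_(x in D) (c * ((Q x - M) * pi x))%:E)%E.
      by apply: eq_integral => x _; rewrite /T; congr EFin; ring.
    rewrite Rintegral_fineK//; last exact: integrableZl_EFin.
    by rewrite RintegralZl// I1 mulr0.
  - apply: cvg_near_cst; have := near_lower_end Da; apply: filterS => x [xa _].
    by rewrite T1 q0 ?mul0r ?mulr0//; left; exact: ltW.
  - apply: cvg_near_cst; have := near_upper_end Db; apply: filterS => x [xb _].
    by rewrite T1 q0 ?mul0r ?mulr0//; right; exact: ltW.
have mg : measurable_fun D (fun x => 2^-1 * s2 x * pi x).
  have -> : (fun x => 2^-1 * s2 x * pi x) = (fun x => 2^-1 * (s2 x * pi x)).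
    by apply/funext => x; rewrite mulrA.
  apply: measurable_funM; first exact: measurable_cst.
  by apply: measurable_open_itv_continuous; exact: cont_diff_continuous.
have ET : (energy x1 x2 pi s2 T <= (v / S)%:E)%E.
  have -> : ((v / S)%:E = \int[mu]_(x in D) ((S^-1)%:E * (2^-1 * s2 x * pi x)%:E))%E.
    rewrite ge0_integralZl_EFin//.
    + by rewrite s2v -EFinM mulrC.
    + exact/measurable_EFinP.
    + by rewrite invr_ge0 ltW.
  rewrite /energy T1; apply: ge0_le_integral => //.
  - by move=> x Dx; rewrite lee_fin mulr_ge0 ?sqr_ge0// g0.
  - apply/measurable_EFinP; apply: measurable_funM => //.
    apply: measurable_funX; apply: measurable_funM => //.
    by apply: measurable_funTS; exact: continuous_measurable_fun.
  - by apply/measurable_EFinP; apply: measurable_funM.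
  - move=> x Dx; rewrite -EFinM lee_fin exprMn c2 [leRHS]mulrC.
    apply: ler_wpM2l; first exact: g0.
    rewrite ler_piMl ?invr_ge0 ?(ltW S0)//.
    by have /andP[? ?] := q01 x; rewrite expr_le1.
have : l <= v / S by rewrite -lee_fin; apply: le_trans ET; apply: minl; exists T.
rewrite ler_pdivlMr//; apply: le_trans.
exact: ler_wpM2l.
Qed.

Lemma lambda1_le (s2 : R -> R) (l : R) : admissible x1 x2 v pi s2 ->
  is_lambda1 x1 x2 pi s2 l -> l <= v / V.
Proof.
move=> adm lam; rewrite ler_pdivlMr//; apply/ler_addgt0Pr => d d0.
have [l0|l0] := leP l 0.
  by apply: (le_trans (mulr_le0_ge0 l0 (ltW V0))); rewrite addr_ge0 ?ltW.
(* The first bound keeps 2 e < V, the second makes the loss 2 l e at most d. *)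
pose e := Num.min (V / 4) (d / (2 * l)).
have e0 : 0 < e by rewrite lt_min !divr_gt0// mulr_gt0.
have eV4 : e <= V / 4 by rewrite ge_min lexx.
have V_gt0 : 0 < V by [].
have eV : 2 * e < V by lra.
have ed : 2 * l * e <= d.
  by rewrite mulrC -ler_pdivlMr ?mulr_gt0// ge_min lexx orbT.
by have := lambda1_clamp_le adm lam e0 eV; lra.
Qed.

Lemma convergence_rates_greatest :
  is_greatest (convergence_rates x1 x2 v pi) (v / V).
Proof.
split; last by move=> l [s2 adm lam]; exact: lambda1_le lam.
by exists (optimal_s2 x1 x2 v pi); [exact: optimal_admissible|exact: optimal_is_lambda1].
Qed.

Lemma max_rateE : max_rate x1 x2 v pi = v / V.
Proof.
have gr := convergence_rates_greatest; rewrite /max_rate.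
have [inm ubm] := xgetPex 0 (ex_intro _ _ gr).
by apply/eqP; rewrite eq_le; apply/andP; split; [exact: gr.2|apply: ubm; exact: gr.1].
Qed.

Lemma optimal_relaxation_timeE : optimal_relaxation_time x1 x2 v pi = V / v.
Proof. by rewrite /optimal_relaxation_time max_rateE div1r invf_div. Qed.

End maximal_rate.

Section mixture.
Context {R : realType}.
Variables (x1 x2 : \bar R) (m : nat) (pi : 'I_m -> R -> R) (p : 'I_m -> R).
Hypothesis hpi : forall i, stationary_density x1 x2 (pi i).
Hypothesis p0 : forall i, 0 <= p i.
Hypothesis p1 : \sum_(i < m) p i = 1.
Local Notation D := (open_itv x1 x2).
Local Notation mu := (@lebesgue_measure R).
Let mD : measurable (D : set (measurableTypeR R)) := @measurable_open_itv R x1 x2.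
Let mix (x : R) := \sum_(i < m) p i * pi i x.

Lemma mixture_integral (g : R -> R) : measurable_fun D g ->
  (forall x, D x -> 0 <= g x) ->
  (\int[mu]_(x in D) (g x * mix x)%:E =
   \sum_(i < m) (p i)%:E * \int[mu]_(x in D) (g x * pi i x)%:E)%E.
Proof.
move=> mg g0.
have gp0 i x : D x -> 0 <= g x * pi i x.
  by move=> Dx; rewrite mulr_ge0 ?g0// ltW// (density_gt0 (hpi i)).
have mgp i : measurable_fun D (fun x => g x * pi i x).
  by apply: measurable_funM => //; exact: measurable_density.
have scale i : ((p i)%:E * \int[mu]_(x in D) (g x * pi i x)%:E =
    \int[mu]_(x in D) ((p i)%:E * (g x * pi i x)%:E))%E.
  rewrite ge0_integralZl_EFin//; first by move=> x Dx; rewrite lee_fin gp0.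
  by apply/measurable_EFinP; exact: mgp.
under [RHS]eq_bigr do rewrite scale.
rewrite -ge0_integral_sum//.
- apply: eq_integral => x _; rewrite /mix mulr_sumr -sumEFin.
  by apply: eq_bigr => i _; rewrite -EFinM mulrCA.
- move=> i; apply/measurable_EFinP.
  by apply: measurable_funM; [exact: measurable_cst|exact: mgp].
- by move=> i x Dx; rewrite -EFinM lee_fin mulr_ge0// gp0.
Qed.

Lemma mixture_density : stationary_density x1 x2 mix.
Proof.
split.
- move=> x Dx; rewrite /mix; apply: cvg_big; first exact: add_continuous.
  by move=> i _; apply: cvgMr; case: (hpi i) => + _ _ _; exact.
- move=> x Dx; have [i pi0] : exists i, 0 < p i.
    apply: contrapT => np; have := oner_eq0 R; rewrite -p1 big1 ?eqxx// => i _.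
    by apply/eqP; rewrite eq_le p0 andbT leNgt; apply/negP => pi0; apply: np; exists i.
  rewrite /mix (bigD1 i)//= ltr_wpDr//; last first.
    by rewrite mulr_gt0// (density_gt0 (hpi i)).
  by apply: sumr_ge0 => j _; rewrite mulr_ge0// ltW// (density_gt0 (hpi j)).
- have := @mixture_integral (fun=> 1) (measurable_cst _) (fun _ _ => ler01).
  under eq_integral do rewrite mul1r.
  move=> ->; under eq_bigr => i _.
    under eq_integral do rewrite mul1r.
    have -> : (\int[mu]_(x in D) (pi i x)%:E = 1)%E by case: (hpi i).
    rewrite mule1; over.
  by rewrite sumEFin p1.
- rewrite mixture_integral; last 2 first.
  + by apply: measurable_funX; exact: measurable_idD.
  + by move=> x _; exact: sqr_ge0.
  apply: lte_sum_pinfty => i _; apply: lte_mul_pinfty.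
  + by rewrite lee_fin.
  + by [].
  + by case: (hpi i).
Qed.

(** The second moment of the mixture about its mean is the average of those of
    the components about the same point, each bounded below by [variance_le]. *)
Lemma variance_concave :
  \sum_(i < m) p i * variance x1 x2 (pi i) <= variance x1 x2 mix.
Proof.
pose M := mean x1 x2 mix.
have mg : measurable_fun D (fun x : R => (x - M) ^+ 2).
  apply: measurable_funX; apply: measurable_funB; first exact: measurable_idD.
  exact: measurable_cst.
rewrite -lee_fin /variance -/M -Rintegral_fineK//; last first.
  exact: (centered_sqr_integrable mixture_density M).
rewrite mixture_integral//; last by move=> x _; exact: sqr_ge0.
rewrite -sumEFin; apply: lee_sum => i _; rewrite EFinM.
apply: lee_wpmul2l; first by rewrite lee_fin.
rewrite Rintegral_fineK//; last exact: (centered_sqr_integrable (hpi i) M).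
by rewrite lee_fin; exact: variance_le.
Qed.

End mixture.

Unset Implicit Arguments.

Theorem lemma1 (R : realType) (x1 x2 : \bar R) (hx : (x1 < x2)%E)
    (v : R) (hv : 0 < v) (m : nat) (pi : 'I_m -> R -> R) (p : 'I_m -> R)
    (hpi : forall i, stationary_density x1 x2 (pi i))
    (hp : forall i, 0 <= p i) (hp1 : \sum_(i < m) p i = 1) :
  let mix := fun x : R => \sum_(i < m) p i * pi i x in
  [/\ forall i, max_rate_exists x1 x2 v (pi i),
      max_rate_exists x1 x2 v mix
    & \sum_(i < m) p i * optimal_relaxation_time x1 x2 v (pi i)
        <= optimal_relaxation_time x1 x2 v mix].
Proof.
move=> mix; have hmix : stationary_density x1 x2 mix := mixture_density hpi hp hp1.
split.
- by move=> i; eexists; exact: convergence_rates_greatest hv (hpi i).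
- by eexists; exact: convergence_rates_greatest hv hmix.
under eq_bigr => i _ do rewrite (optimal_relaxation_timeE hv (hpi i)) mulrA.
rewrite (optimal_relaxation_timeE hv hmix) -mulr_suml ler_pM2r ?invr_gt0//.
exact: variance_concave hpi hp hp1.
Qed.
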